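(* Let $n\ge4$ be even and let $K\in\mathcal{P}(n+1,n)$ be an exp-maximal decomposable minimal cone with extreme vectors $x_1,\ldots,x_{n+1}$. Suppose that $K=\operatorname{pos}\{x_2\}\oplus\operatorname{pos}\{x_1,x_3,x_4,\ldots,x_{n+1}\}$, where $x_1,x_3,x_4,\ldots,x_{n+1}$ satisfy the relation $$x_1+x_4+x_6+\cdots+x_{n-2}+x_n=x_3+x_5+\cdots+x_{n-1}+x_{n+1}.$$ For every $\alpha,\beta>0$, let $A_{\alpha,\beta}$ be the exp-maximal $K$-primitive matrix defined by $$A_{\alpha,\beta}x_1=\alpha x_2+x_3,\quad A_{\alpha,\beta}x_2=\beta x_3,\quad A_{\alpha,\beta}x_i=x_{i+1}\ (3\le i\le n),\quad A_{\alpha,\beta}x_{n+1}=x_1+\alpha x_2.$$ Then: (i) $\Phi(A_{\alpha,\beta})$ is a $3$-dimensional simplicial face of $\pi(K)$, independent of the choice of the positive scalars $\alpha,\beta$; its relative interior consists of positive multiples of matrices of the form $A_{\tilde\alpha,\tilde\beta}$, $\tilde\alpha,\tilde\beta>0$. (ii) Every exp-maximal $K$-primitive matrix is cone-equivalent to a positive multiple of some $A_{1,\beta}$. (iii) For distinct positive scalars $\beta_1,\beta_2$, the matrices $A_{1,\beta_1},A_{1,\beta_2}$, or their positive multiples, are pairwise not cone-equivalent.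
   Context: A proper cone is a closed, pointed ($K\cap(-K)=\{0\}$) convex cone with nonempty interior. $\operatorname{pos}S$ is the set of all nonnegative linear combinations of elements of $S$. A face of a cone $K$ is a subcone $F\subseteq K$ such that $y\in F$ whenever $x\in F$ and $y,x-y\in K$; $\Phi(x)$ is the smallest face of the cone containing $x$. A nonzero $x\in K$ is an extreme vector if $\Phi(x)=\{\lambda x:\lambda\ge0\}$ (an extreme ray). A polyhedral cone is a proper cone (in its span) with finitely many extreme rays; it is simplicial if the number of extreme rays equals its dimension. $\mathcal{P}(m,n)$ is the set of $n$-dimensional polyhedral cones with exactly $m$ extreme rays. An $n$-dimensional minimal cone is a member of $\mathcal{P}(n+1,n)$. A cone is decomposable if it is the direct sum of two nonzero subcones. $\pi(K)$, the set of real matrices $A$ with $AK\subseteq K$, is itself a proper cone in the space of $n\times n$ real matrices, and $\Phi(A)$ for $A\in\pi(K)$ is the face of $\pi(K)$ generated by $A$. $A\in\pi(K)$ is $K$-primitive if $A^p(K\setminus\{0\})\subseteq\operatorname{int}K$ for some positive integer $p$; the least such $p$ is the exponent $\gamma(A)$. For polyhedral $K$, $\gamma(K)=\max\{\gamma(A):A\text{ is }K\text{-primitive}\}$; a $K$-primitive $A$ is exp-maximal if $\gamma(A)=\gamma(K)$; $K_0\in\mathcal{P}(m,n)$ is exp-maximal if $\gamma(K_0)=\max\{\gamma(K):K\in\mathcal{P}(m,n)\}$. $A_1\in\pi(K_1)$ and $A_2\in\pi(K_2)$ are cone-equivalent if there is a linear isomorphism $P$ with $PK_2=K_1$ and $P^{-1}A_1P=A_2$.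 *)

(* Defs.v *)
From mathcomp Require Export all_boot all_order all_algebra.
From mathcomp Require Export all_classical all_reals all_analysis.
Export Order.TTheory GRing.Theory Num.Theory.
Export numFieldNormedType.Exports.

Set Implicit Arguments.
Unset Strict Implicit.
Unset Printing Implicit Defensive.

Local Open Scope classical_set_scope.
Local Open Scope ring_scope.

(* Cones are sets of p x q matrices, so that the same notions apply to cones
   of column vectors ('cV[R]_n = 'M[R]_(n, 1)) and to pi K in 'M[R]_n. *)
Section Cones.
Variables (R : realType) (p q : nat).
Local Notation V := 'M[R]_(p, q).
Implicit Types (S K F : set V) (x y : V).

Definition lin_span S : set V :=
  [set x | exists k (c : 'I_k -> R) (v : 'I_k -> V),
    (forall i, S (v i)) /\ x = \sum_(i < k) c i *: v i].

Definition pos S : set V :=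
  [set x | exists k (c : 'I_k -> R) (v : 'I_k -> V),
    (forall i, 0 <= c i /\ S (v i)) /\ x = \sum_(i < k) c i *: v i].

Definition convex_cone K : Prop :=
  [/\ K 0,
      (forall x y, K x -> K y -> K (x + y)) &
      (forall c x, 0 <= c -> K x -> K (c *: x))].

Definition pointed K : Prop := forall x, K x -> K (- x) -> x = 0.

Definition cone_dim K (d : nat) : Prop :=
  exists2 U : {vspace V}, lin_span K = [set x | x \in U] & \dim U = d.

(* The affine hull of a convex cone is its linear span. *)
Definition relint K : set V :=
  [set x | K x /\ within (lin_span K) (nbhs x) K].

Definition proper_cone_in_span K : Prop :=
  [/\ convex_cone K, closed K, pointed K & relint K !=set0].

Definition is_face K F : Prop :=
  [/\ convex_cone F, F `<=` K &
      (forall x y, F x -> K y -> K (x - y) -> F y)].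

Definition Phi K x : set V := smallest (is_face K) [set x].

Definition ray x : set V := [set l *: x | l in [set l : R | 0 <= l]].

Definition extreme_vector K x : Prop :=
  [/\ x != 0, K x & Phi K x = ray x].

Definition extreme_rays K : set (set V) := [set ray x | x in extreme_vector K].

Definition polyhedral_cone K : Prop :=
  proper_cone_in_span K /\ finite_set (extreme_rays K).

Definition simplicial_cone K : Prop :=
  polyhedral_cone K /\
  exists2 d, cone_dim K d & (extreme_rays K #= `I_d)%card.

Definition direct_sum (K K1 K2 : set V) : Prop :=
  [/\ convex_cone K1, convex_cone K2,
      K = [set x + y | x in K1 & y in K2] &
      lin_span K1 `&` lin_span K2 = [set 0]].

Definition decomposable K : Prop :=
  exists K1 K2 : set V, [/\ direct_sum K K1 K2, K1 <> [set 0] & K2 <> [set 0]].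

End Cones.

Section ConePreservingMatrices.
Variables (R : realType) (n : nat).
Implicit Types (K : set 'cV[R]_n) (A B P : 'M[R]_n).

(* The class P(m,n). *)
Definition in_P (m : nat) K : Prop :=
  [/\ polyhedral_cone K, cone_dim K n & (extreme_rays K #= `I_m)%card].

Definition minimal_cone K : Prop := in_P n.+1 K.

Definition pi_cone K : set 'M[R]_n :=
  [set A | forall x, K x -> K (A *m x)].

Definition maps_into_interior K A : Prop :=
  forall x, K x -> x != 0 -> interior K (A *m x).

Definition primitive K A : Prop :=
  pi_cone K A /\ exists2 p, (0 < p)%N & maps_into_interior K (A ^+ p).

(* g is the exponent of the K-primitive matrix A. *)
Definition exponent K A (g : nat) : Prop :=
  [/\ primitive K A, (0 < g)%N, maps_into_interior K (A ^+ g) &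
      (forall p, (0 < p)%N -> maps_into_interior K (A ^+ p) -> (g <= p)%N)].

(* g = gamma(K), the maximum of the exponents of the K-primitive matrices. *)
Definition cone_exponent K (g : nat) : Prop :=
  (exists A, exponent K A g) /\ (forall A h, exponent K A h -> (h <= g)%N).

Definition exp_maximal_mx K A : Prop :=
  exists2 g, exponent K A g & cone_exponent K g.

Definition exp_maximal_cone (m : nat) K : Prop :=
  in_P m K /\
  exists2 g, cone_exponent K g &
    forall K' h, in_P m K' -> cone_exponent K' h -> (h <= g)%N.

Definition cone_equivalent (K1 : set 'cV[R]_n) (A1 : 'M[R]_n)
    (K2 : set 'cV[R]_n) (A2 : 'M[R]_n) : Prop :=
  exists P, [/\ P \in unitmx, [set P *m x | x in K2] = K1 &
                invmx P *m A1 *m P = A2].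

(* One representative x 1, ..., x n.+1 for each extreme ray of K; the other
   values of x are irrelevant. *)
Definition extreme_vectors K (x : nat -> 'cV[R]_n) : Prop :=
  [/\ (forall i, (1 <= i <= n.+1)%N -> extreme_vector K (x i)),
      (forall i j, (1 <= i <= n.+1)%N -> (1 <= j <= n.+1)%N ->
        ray (x i) = ray (x j) -> i = j) &
      (forall y, extreme_vector K y ->
        exists2 i, (1 <= i <= n.+1)%N & ray y = ray (x i))].

Definition A_equations (x : nat -> 'cV[R]_n) (alpha beta : R) A : Prop :=
  [/\ A *m x 1%N = alpha *: x 2%N + x 3%N,
      A *m x 2%N = beta *: x 3%N,
      (forall i, (3 <= i <= n)%N -> A *m x i = x i.+1) &
      A *m x n.+1 = x 1%N + alpha *: x 2%N].

End ConePreservingMatrices.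

(* Main.v *)
(** Write [K] as the set of nonnegative combinations of its extreme vectors,
    whose only linear relation is the given one.  For a [K]-primitive [B],
    draw an edge from [x_i] to [x_j] when [B x_i - eps x_j] lies in [K] for
    some [eps > 0].  A closed walk of length [s] through [x_j] puts
    [B^(s(n-1)) x_j] in the interior, because a facet functional vanishing
    there would vanish on the whole [B^s]-orbit of [x_j] by Cayley-Hamilton.
    Hence an exponent of at least [n(n-1)] forces all closed walks to have
    length at least [n], which leaves only digraphs with [n + 1] vertices close
    to the Wielandt digraph; applying [B] to the linear relation then pins down
    its coefficients, so that [B] is a multiple of some [A_(1,beta)] up to an
    automorphism of [K].  The exponent of [A_(alpha,beta)] is read off the
    recurrence [A^(n+1) x_3 = (1 + alpha beta) A x_3 + alpha beta x_3].  In (iii),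
    the trace [1] fixes the scalar factor and the recurrence fixes [beta]. *)
Require Import Defs.
From mathcomp Require Import zify ring lra.

Set Implicit Arguments.
Unset Strict Implicit.
Unset Printing Implicit Defensive.

(** * Digraphs whose closed walks are long *)

(** The obstacle is the linear relation. Coefficients over the extreme vectors are determined only
    up to multiples of it, so adjacency read off from chosen coefficients would not be intrinsic,
    and an interior point need not be written with all coefficients positive. Both notions are
    therefore phrased through the order of [K] and through facet functionals, which vanish on the
    relation; coefficients return only once a single choice realises all edges. The value
    [n * (n - 1)] of the maximal exponent is not assumed. The classification applies to every
    primitive matrix whose exponent is at least that large, and conjugation to a multiple of some
    [A_(1,beta)] then shows the exponent to be equal to it. One parameter survives because [x_2]
    does not occur in the relation: it can be rescaled independently of the other extreme vectors,
    which turns [(alpha, beta)] into [(1, alpha beta)]. *)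

Section Walks.
Variables (V : finType) (e : rel V).

Definition walk k v w := exists p, [/\ path e v p, size p = k & last v p = w].

Lemma walk0 v : walk 0 v v.
Proof. by exists [::]. Qed.

Lemma walk1 v w : e v w -> walk 1 v w.
Proof. by move=> evw; exists [:: w]; rewrite /= evw. Qed.

Lemma walkD k l u v w : walk k u v -> walk l v w -> walk (k + l) u w.
Proof.
move=> [p [pp <- <-]] [q [pq <- <-]]; exists (p ++ q).
by rewrite cat_path pp pq size_cat last_cat.
Qed.

Lemma walk_iter (f : V -> V) k v :
  (forall u, e u (f u)) -> walk k v (iter k f v).
Proof.
move=> fe; elim: k => [|k IHk]; first exact: walk0.
by rewrite -addn1; apply: (walkD IHk); rewrite addn1 iterS; apply: walk1.
Qed.

(** Both walks are cut to simple ones, the closed walk to a cycle and the other to a path, and the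
    path is stopped at the first vertex it shares with the cycle. Its earlier vertices avoid the
    cycle, so [d' + s'] counts distinct vertices. *)
Lemma short_walk d s i v : walk d i v -> walk s v v -> 0 < s ->
  exists d' s' u, [/\ walk d' i u, walk s' u u, 0 < s' <= s & d' + s' <= #|V|].
Proof.
move=> [q [eq _ lq]] [p [ep <- lp]].
case: (lastP p) ep lp => [|p0 v'] // ep; rewrite last_rcons => v'v _.
move: ep; rewrite {}v'v rcons_path size_rcons => /andP[ep0 elp0].
case/shortenP: ep0 elp0 => {}p ep up sp elp.
have sz : size p <= size p0 by apply: uniq_leq_size sp; case/andP: up.
have cc : cycle e (v :: p) by rewrite /= rcons_path ep.
case/shortenP: eq lq => {}q eq uq _ lq.
set c := v :: p in up cc.
have hc : has (mem c) (i :: q).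
  by apply/hasP; exists v; [rewrite -lq mem_last | exact: mem_head].
set k := find (mem c) (i :: q).
have kq : k <= size q by rewrite -ltnS -[X in _ < X]/(size (i :: q)) -has_find.
pose u := nth i (i :: q) k.
have uc : u \in c by exact: (nth_find i hc).
exists k, (size p).+1, u; split.
- exists (take k q); split.
  + by rewrite -[q](cat_take_drop k) cat_path in eq; case/andP: eq.
  + by rewrite size_takel.
  + by rewrite (last_nth i) size_takel // /u /= -[_ :: take k q]/(take k.+1 (i :: q))
      nth_take.
- have [m c' rc] := rot_to uc.
  exists (rcons c' u); rewrite last_rcons size_rcons; split=> //.
    by move: cc; rewrite -(rot_cycle m) rc.
  by have := size_rot m c; rewrite rc => -[->].
- by rewrite ltnS.
have ucat : uniq (take k (i :: q) ++ c).
  rewrite cat_uniq take_uniq // up andbT.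
  apply/hasPn => x xc; apply/negP => /(nthP i)[j].
  rewrite size_takel 1?leqW // => jk; rewrite nth_take // => jx.
  by have := before_find i jk; rewrite jx inE; move: xc => /= ->.
have := max_card (mem (take k (i :: q) ++ c)).
by rewrite (card_uniqP ucat) size_cat size_takel // leqW.
Qed.
End Walks.

Section TwoCycleLengths.
Variables (V : finType) (n : nat) (e : rel V) (i : V).
Hypotheses (n_ge4 : 4 <= n) (cardV : #|V| = n.+1).
Hypothesis e_out : forall v, exists w, e v w.
(** Only vertices reachable from [i] are constrained: a large exponent is caused by a single extreme
    vector that enters the interior late. *)
Hypothesis long : forall d s v, walk e d i v -> walk e s v v -> 0 < s -> n <= s.
(** Primitivity will provide this: extreme vectors indexed by such a [T] would be moved from extreme
    ray to extreme ray forever. *)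
Hypothesis no_rotation : forall T : {set V}, T != finset.set0 ->
  (forall t, t \in T -> exists2 u, u \in T & forall w, e t w -> w = u) -> False.

(* The out-neighbourhoods are those of the directed cycle
   [y 0 -> y 1 -> .. -> y n -> y 0] with the extra edge [y n -> y 1], up to the
   out-neighbours of [y 0], which may be [y 1], [y 2] or both. *)
Definition wielandt_labelling (y : nat -> V) :=
  [/\ forall a b, a <= n -> b <= n -> y a = y b -> a = b,
      forall w, e (y n) w <-> w = y 0 \/ w = y 1,
      forall w, e (y 0) w -> w = y 1 \/ w = y 2 &
      forall k w, 0 < k < n -> e (y k) w -> w = y k.+1].

Lemma long_iter f d v a b : (forall u, e u (f u)) -> walk e d i v ->
  a < b -> iter a f v = iter b f v -> a + n <= b.
Proof.
move=> fe iv ab eq; rewrite -(subnK (ltnW ab)) addnC leq_add2r.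
apply: (long (walkD iv (walk_iter a v fe))); last by rewrite subn_gt0.
by rewrite {2}eq -{2}(subnK (ltnW ab)) iterD; apply: walk_iter.
Qed.

(** By [long_iter] a repetition needs [a = 0], [b = n] and [m = n + 1]. Then both [n] and [n + 1]
    are periods of [v], so [f] fixes [v], which is a closed walk of length 1. *)
Lemma orbit_inj f d v m : (forall u, e u (f u)) -> walk e d i v ->
    iter m f v = v -> 0 < m <= n.+1 ->
  forall a b, a < m -> b < m -> iter a f v = iter b f v -> a = b.
Proof.
move=> fe iv fm m_le.
have aux a b : a < b < m -> iter a f v <> iter b f v.
  move=> /andP[ab bm] eq; have anb := long_iter fe iv ab eq.
  have a0 : a = 0 by lia.
  have bn : b = n by lia.
  have mn : m = n.+1 by lia.
  have fvv : iter 0 f v = iter 1 f v.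
    by move: eq; rewrite a0 bn /= => {2}->; rewrite -iterS -mn fm.
  by have := long_iter fe iv (isT : 0 < 1) fvv; lia.
move=> a b am bm eq; case: (ltngtP a b) => // [ab|ba].
  by case: (aux a b); rewrite ?ab.
by case: (aux b a); rewrite ?ba.
Qed.

(** The orbit of [f] is a cycle through all [n + 1] vertices. An edge from [v] to its [j]-th iterate
    closes up in [n + 2 - j] steps, so besides [f v] only [f (f v)] can be an out-neighbour. *)
Lemma hamiltonian_labelling f d z : (forall u, e u (f u)) -> walk e d i z ->
  iter n.+1 f z = z -> exists y, wielandt_labelling y.
Proof.
move=> fe iz fz.
have onto v d' : walk e d' i v -> iter n.+1 f v = v ->
    forall w, exists2 j, j <= n & w = iter j f v.
  move=> iv fv w.
  have inj : injective (fun j : 'I_n.+1 => iter j f v).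
    move=> a b eq; apply/val_inj/(orbit_inj fe iv fv _ _ _ eq) => //.
    by rewrite ltnSn.
  have cardle : #|V| <= #|'I_n.+1| by rewrite cardV card_ord.
  have /codomP[j ->] := inj_card_onto inj cardle w.
  by exists j; rewrite // -ltnS.
have cyc v : iter n.+1 f v = v.
  have [j _ ->] := onto z d iz fz v.
  by rewrite -iterD addnC iterD fz.
have reach v : exists d', walk e d' i v.
  have [j _ ->] := onto z d iz fz v.
  by exists (d + j); apply: walkD (walk_iter _ _ _).
have long' v s : walk e s v v -> 0 < s -> n <= s.
  by have [d' iv] := reach v; apply: long iv.
have orb v w : exists2 j, 0 < j <= n.+1 & w = iter j f v.
  have [d' iv] := reach v.
  have [[|j] jn ->] := onto v d' iv (cyc v) w; first by exists n.+1; rewrite ?cyc ?leqnn.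
  by exists j.+1 => //; apply: leqW jn.
have chord v w : e v w -> w = f v \/ w = f (f v).
  move=> vw; have [j /andP[j0 jn] wE] := orb v w.
  have : walk e (1 + (n.+1 - j)) v v.
    apply: walkD (walk1 vw) _.
    by have := walk_iter (n.+1 - j) w fe; rewrite {2}wE -iterD subnK // cyc.
  move=> /long'-/(_ isT); have {jn} : j <= n.+1 := jn.
  case: j j0 wE => [|[|[|j]]] // _ ->; [by left|by right|lia].
pose D v := e v (f (f v)).
(* Two chords starting [j] apart shorten the cycle twice, to length [n - 1]. So there are at most
   two chord sources, and two of them are adjacent. *)
have farD v j : D v -> 2 <= j <= n.-1 -> D (iter j f v) -> False.
  move=> Dv /andP[j2 jn] Djv.
  have : walk e (1 + ((j - 2) + (1 + (n.+1 - (j + 2))))) v v.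
    apply: walkD (walk1 Dv) _.
    apply: (@walkD _ _ _ _ _ (iter j f v)).
      by rewrite -[X in iter X](subnK j2) iterD; apply: walk_iter.
    apply: walkD (walk1 Djv) _.
    have := walk_iter (n.+1 - (j + 2)) (f (f (iter j f v))) fe.
    by rewrite -!iterS -iterD (_ : n.+1 - _ + _ = n.+1) ?cyc //; lia.
  by move=> /long'-/(_ isT); lia.
have [v Dv] : exists v, D v.
  apply: contrapT => /forallNP nD; apply: (no_rotation (T := finset.setT)).
    by apply/set0Pn; exists i.
  by move=> t _; exists (f t); rewrite ?inE // => w /[dup] tw /chord[//|wE];
    case: (nD t); rewrite /D -wE.
(* Of two adjacent sources [v] is the first. It becomes [y n], and its successor becomes [y 0],
   whose out-neighbours are left open. *)
have {v Dv} [v Dv Dv'] : exists2 v, D v & forall j, 2 <= j <= n -> ~ D (iter j f v).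
  have [Dn|Dn] := boolP (D (iter n f v)).
    exists (iter n f v) => // j jn Dj; case: (ltnP j n) => jn'.
      by apply: (farD _ j Dn _ Dj); lia.
    have jE : j = n by lia.
    move: Dj; rewrite jE -iterD -{1}(prednK (_ : 0 < n)) ?addSnnS; last lia.
    by rewrite iterD cyc; apply: farD Dv _; lia.
  exists v => // j jn Dj; case: (ltnP j n) => jn'.
    by apply: (farD _ j Dv _ Dj); lia.
  by move/negP: Dn; apply; have <- : j = n by lia.
exists (fun j => iter j.+1 f v); split.
- move=> a b an bn; rewrite !iterSr => eq.
  have [d' iv] := reach (f v).
  by apply: (orbit_inj fe iv (cyc _) _ _ _ eq); rewrite ?ltnS ?leqnn.
- move=> w; rewrite cyc; split=> [/chord //|[]->]; [exact: fe|exact: Dv].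
- by move=> w /chord.
move=> k w /andP[k0 kn] /[dup] kw /chord[//|wE].
by case: (Dv' k.+1); [rewrite ltnS k0 | move: kw; rewrite wE].
Qed.

(** The orbit [O] is a chordless cycle missing one vertex [w]. By [no_rotation] some [v] in [O]
    points to [w], and every edge out of [w] returns one or two places after [v]. One place after
    gives a Hamiltonian cycle; two places after makes [w] parallel to [f v], and then [w] is [y 0]
    and [f v] is [y 1]. *)
Lemma short_cycle_labelling f d z : (forall u, e u (f u)) -> walk e d i z ->
  iter n f z = z -> exists y, wielandt_labelling y.
Proof.
move=> fe iz fz; have n_gt0 : 0 < n by lia.
pose O := [set iter (val j) f z | j : 'I_n].
have nn : 0 < n <= n.+1 by rewrite n_gt0 leqnSn.
have inO j : iter j f z \in O.
  have -> : iter j f z = iter (j %% n) f z.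
    rewrite {1}(divn_eq j n) addnC iterD mulnC; congr iter.
    by elim: (j %/ n) => [|k IHk]; rewrite ?muln0 // mulnS iterD IHk.
  by apply/imsetP; exists (Ordinal (ltn_pmod j n_gt0)).
have cardO : #|O| = n.
  rewrite card_imset ?card_ord // => a b eq.
  by apply/val_inj/(orbit_inj fe iz fz nn _ _ eq); exact: ltn_ord.
have [w Ow] : exists w, ~: O = [set w].
  by apply/cards1P; have := cardsC O; rewrite cardO cardV; lia.
have wO u : u \in O \/ u = w.
  have [|uO] := boolP (u \in O); first by left.
  by right; apply/set1P; rewrite -Ow inE.
have wNO : w \notin O by have := set11 w; rewrite -Ow inE.
have reachO v : v \in O -> exists d', walk e d' i v.
  by move=> /imsetP[j _ ->]; exists (d + j); apply: walkD (walk_iter _ _ _).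
have cyc v : v \in O -> iter n f v = v.
  by move=> /imsetP[j _ ->]; rewrite -iterD addnC iterD fz.
have stable k v : v \in O -> iter k f v \in O.
  by move=> /imsetP[j _ ->]; rewrite -iterD.
have orb v u : v \in O -> u \in O -> exists2 j, 0 < j <= n & u = iter j f v.
  move=> vO uO; have [d' iv] := reachO v vO.
  have inj : {in [set: 'I_n] &, injective (fun j : 'I_n => iter j f v)}.
    by move=> a b _ _ eq; apply/val_inj/(orbit_inj fe iv (cyc v vO) nn _ _ eq).
  have : u \in [set iter (val j) f v | j : 'I_n].
    suff -> : [set iter (val j) f v | j : 'I_n] = O by [].
    apply/eqP; rewrite eqEcard cardO card_imset ?card_ord ?leqnn ?andbT.
      by apply/fintype.subsetP => _ /imsetP[j _ ->]; apply: stable.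
    by move=> a b; apply: inj; rewrite inE.
  move=> /imsetP[[[|j] jn] _ ->]; first by exists n; rewrite ?cyc ?leqnn ?n_gt0.
  by exists j.+1 => //; apply: ltnW jn.
have chord v u : v \in O -> u \in O -> e v u -> u = f v.
  move=> vO uO vu; have [j /andP[j0 jn] uE] := orb v u vO uO.
  have [d' iv] := reachO v vO.
  have : walk e (1 + (n - j)) v v.
    apply: walkD (walk1 vu) _.
    by have := walk_iter (n - j) u fe; rewrite {2}uE -iterD subnK // cyc.
  by move=> /(long iv)-/(_ isT); case: j j0 jn uE => [|[|j]] // _ jn _; lia.
have [v vO vw] : exists2 v, v \in O & e v w.
  apply: contrapT => /forall2NP nw; apply: (no_rotation (T := O)).
    by apply/set0Pn; exists (iter 0 f z).
  move=> t tO; exists (f t); first exact: (stable 1).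
  move=> u tu; have [uO|uw] := wO u; first exact: chord.
  by case: (nw t) => // -[]; rewrite -uw.
have from_w u d' : u \in O -> walk e d' i u -> e u w ->
    forall v', e w v' -> v' = f u \/ v' = f (f u).
  move=> uO iu uw v' wv'.
  have [v'O|v'w] := wO v'; last first.
    rewrite v'w in wv'; have := long (walkD iu (walk1 uw)) (walk1 wv') isT.
    by lia.
  have [j /andP[j0 jn] v'E] := orb u v' uO v'O.
  have : walk e (1 + (1 + (n - j))) u u.
    apply: walkD (walk1 uw) _; apply: walkD (walk1 wv') _.
    by have := walk_iter (n - j) v' fe; rewrite {2}v'E -iterD subnK // cyc.
  move=> /(long iu)-/(_ isT).
  by case: j j0 jn v'E => [|[|[|j]]] // _ _ ->; [left|right|lia].
have ham u : u \in O -> e u w -> e w (f u) -> exists y, wielandt_labelling y.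
  move=> uO uw wfu; have [d' iu] := reachO u uO.
  (* [f'] inserts [w] between [u] and [f u], which lengthens the cycle to [n + 1]. *)
  pose f' x := if x == u then w else if x == w then f u else f x.
  have uNw : u != w by apply: contraNneq wNO => <-.
  have f'u : f' u = w by rewrite /f' eqxx.
  have f'w : f' w = f u by rewrite /f' eqxx eq_sym (negPf uNw).
  apply: (@hamiltonian_labelling f' d' u) => //.
    by move=> x; rewrite /f'; case: eqP => [->//|_]; case: eqP => [->|].
  rewrite (_ : n.+1 = n.-1 + 2); last by rewrite addn2 prednK.
  rewrite iterD /= f'u f'w.
  have f'E k : k <= n.-1 -> iter k f' (f u) = iter k.+1 f u.
    elim: k => // k IHk kn; rewrite iterS IHk 1?ltnW // /f'.
    case: eqP => [eq|_].
      have : k.+1 = 0; last by [].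
      by apply: (@orbit_inj f _ _ _ fe iu (cyc u uO) nn k.+1 0 _ _ eq); lia.
    by case: eqP => // eq; case/negP: wNO; rewrite -eq stable.
  by rewrite f'E // prednK ?cyc.
have [wfv|nwfv] := boolP (e w (f v)); first exact: (ham v).
have [d' iv] := reachO v vO.
have w_out v' : e w v' -> v' = f (f v).
  by move=> /[dup] wv' /(from_w v d' vO iv vw)[] // eq; case/negP: nwfv; rewrite -eq.
have wffv : e w (f (f v)) by have [v' wv'] := e_out w; rewrite -(w_out v').
have [[u [uO uw wfu]]|noham] := pselect (exists u, [/\ u \in O, e u w & e w (f u)]).
  exact: (ham u).
have uniq_in u : u \in O -> e u w -> u = v.
  move=> uO uw; have [d'' iu] := reachO u uO.
  have [eq|eq] := from_w u _ uO iu uw _ wffv.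
    by case: noham; exists u; rewrite -eq.
  by rewrite -(cyc u uO) -(cyc v vO) -(subnK (_ : 2 <= n)) ?iterD /= ?eq //; lia.
exists (fun k => if k is k'.+1 then iter k f v else w); split.
- have aux k : w <> iter k.+1 f v by move=> eq; case/negP: wNO; rewrite eq stable.
  move=> [|a] [|b] // an bn; [by move/aux|by move/esym/aux|].
  rewrite !iterSr => eq; congr _.+1.
  apply: (orbit_inj fe (walkD iv (walk1 (fe v))) _ nn an bn eq).
  by rewrite cyc // (stable 1).
- move=> u; case: n n_gt0 cyc chord => // m _ cyc chord; rewrite cyc //=.
  split=> [vu|[]-> //]; have [uO|->] := wO u; last by left.
  by right; apply: chord.
- by move=> u /w_out ->; right.
- move=> [|k] u //= kn ku; have kO : iter k.+1 f v \in O by apply: stable.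
  have [uO|uw] := wO u; first exact: chord uO ku.
  have kv : iter k.+1 f v = iter 0 f v by apply: uniq_in kO _; rewrite -uw.
  have : k.+1 = 0; last by [].
  by apply: (@orbit_inj f _ _ _ fe iv (cyc v vO) nn k.+1 0 _ _ kv).
Qed.

Theorem exists_wielandt_labelling : exists y, wielandt_labelling y.
Proof.
have [f fe] := choice e_out.
have [a [b [ab bn eq]]] : exists a b, [/\ a < b, b <= n.+1 & iter a f i = iter b f i].
  apply: contrapT => nab.
  have inj : injective (fun j : 'I_n.+2 => iter j f i).
    move=> a b eq; apply/val_inj; case: (ltngtP a b) => // ltab; case: nab.
      by exists a, b; rewrite ltab -ltnS.
    by exists b, a; rewrite ltab -ltnS.
  by have := leq_card _ inj; rewrite cardV card_ord ltnn.
have anb := long_iter fe (walk0 e i) ab eq.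
(* A repetition at distance at least [n] within indices up to [n + 1] starts at index 0 or 1, so
   [f i] already has period [n] or [n + 1]. *)
have [z iz fz] : exists2 z, walk e 1 i z & iter n f z = z \/ iter n.+1 f z = z.
  exists (f i); first exact: walk1.
  case: a b eq ab bn anb => [|[|a]] b eq _ bn anb; last lia.
    have : b = n \/ b = n.+1 by lia.
    by case=> bE; [left|right]; rewrite -bE -iterSr iterS -eq.
  by left; rewrite -iterSr (_ : n.+1 = b) ?eq //; lia.
by case: fz; [apply: short_cycle_labelling iz | apply: hamiltonian_labelling iz].
Qed.

End TwoCycleLengths.

Local Open Scope classical_set_scope.
Local Open Scope ring_scope.

(** * Linear functionals and simplicial cones in spaces of matrices *)

Lemma nbhs_sub_ray (R : realType) p q (S : set 'M[R]_(p, q)) (y z : 'M[R]_(p, q)) :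
  nbhs y S -> exists2 eps : R, 0 < eps & S (y - eps *: z).
Proof.
move=> yS.
have cont : continuous (fun eps : R => y - eps *: z).
  move=> e; apply: cvgB; first exact: cvg_cst.
  by apply: cvgZr_tmp.
have : nbhs (0 : R) [set eps | S (y - eps *: z)].
  by apply: cont; rewrite scale0r subr0.
move/nbhs_ballP => [e /= e0 be].
exists (e / 2); first by rewrite divr_gt0.
by apply: be; rewrite /ball /= sub0r normrN gtr0_norm ?divr_gt0 // ltr_pdivrMr //
  ltr_pMr // ltr1n.
Qed.

Section ScalarFunctionals.
Variables (R : realType) (p q : nat) (f : 'M[R]_(p, q) -> R).
Hypothesis f_lin : scalar f.

Lemma scalar_functional0 : f 0 = 0.
Proof. by have := f_lin (-1) 0 0; rewrite scaler0 add0r mulN1r addNr. Qed.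

Lemma scalar_functionalD u v : f (u + v) = f u + f v.
Proof. by rewrite -[u]scale1r f_lin mul1r scale1r. Qed.

Lemma scalar_functionalZ a u : f (a *: u) = a * f u.
Proof. by rewrite -[a *: u]addr0 f_lin scalar_functional0 addr0. Qed.

Lemma scalar_functionalB u v : f (u - v) = f u - f v.
Proof. by rewrite scalar_functionalD -scaleN1r scalar_functionalZ mulN1r. Qed.

Lemma scalar_functional_sum I (s : seq I) (F : I -> 'M[R]_(p, q)) :
  f (\sum_(i <- s) F i) = \sum_(i <- s) f (F i).
Proof. exact: (big_morph f scalar_functionalD scalar_functional0). Qed.

Lemma scalar_functional_continuous : continuous f.
Proof.
have -> : f = fun M => \sum_i \sum_j M i j * f (delta_mx i j).
  apply/funext => M; rewrite {1}(matrix_sum_delta M).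
  rewrite scalar_functional_sum; apply: eq_bigr => i _.
  rewrite scalar_functional_sum; apply: eq_bigr => j _.
  exact: scalar_functionalZ.
apply: (continuous_big add_continuous) => i _.
apply: (continuous_big add_continuous) => j _ M.
by apply: cvgMr_tmp; [exact: (nbhs_filter M)|exact: (@coord_continuous R p q i j M)].
Qed.

Lemma nbhs_scalar_gt0 y : 0 < f y -> \forall z \near y, 0 < f z.
Proof.
move=> fy; have : nbhs (f y) [set t | 0 < t].
  by apply: open_nbhs_nbhs; split; [exact: open_gt|].
by move/(@scalar_functional_continuous y).
Qed.

Lemma closed_scalar_ge0 : closed [set y | 0 <= f y].
Proof.
apply: (@closed_comp _ _ f [set y | 0 <= y]); last exact: closed_ge.
by move=> y _; apply: scalar_functional_continuous.
Qed.

End ScalarFunctionals.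

(** * Simplicial cones given by a biorthogonal system *)

Section SimplicialCone.
Variables (R : realType) (p q d : nat).
Variables (E : 'I_d -> 'M[R]_(p, q)) (g : 'I_d -> 'M[R]_(p, q) -> R).
Hypothesis g_lin : forall i, scalar (g i).
Hypothesis g_dual : forall i j, g i (E j) = (i == j)%:R.
Implicit Types (M N : 'M[R]_(p, q)) (a : 'I_d -> R).

(** Applied below with [d = 3] in a space of matrices, where [E] spans a proper subspace; hence
    membership is an equation, [M = \sum_i g i M *: E i], together with the signs of the [g i M]. *)
Definition simplex_cone : set 'M[R]_(p, q) :=
  [set M | exists2 a : 'I_d -> R, forall i, 0 <= a i & M = \sum_i a i *: E i].
Local Notation C := simplex_cone.

Lemma dual_sum a i : g i (\sum_j a j *: E j) = a i.
Proof.
rewrite (scalar_functional_sum (g_lin i)) (bigD1 i) //= big1 ?addr0 => [|j ji].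
  by rewrite (scalar_functionalZ (g_lin i)) g_dual eqxx mulr1.
by rewrite (scalar_functionalZ (g_lin i)) g_dual eq_sym (negPf ji) mulr0.
Qed.

Lemma simplex_coneP M :
  C M <-> (forall i, 0 <= g i M) /\ M = \sum_i g i M *: E i.
Proof.
split=> [[a a0 ->]|[g0 ME]]; last by exists (g^~ M).
split=> [i|]; first by rewrite dual_sum.
by apply: eq_bigr => i _; rewrite dual_sum.
Qed.

Lemma simplex_cone_gen i : C (E i).
Proof.
exists (fun j => (j == i)%:R) => [j|]; first exact: ler0n.
by rewrite (bigD1 i) //= eqxx scale1r big1 ?addr0 // => j /negPf ->; rewrite scale0r.
Qed.

Lemma simplex_cone_convex : convex_cone C.
Proof.
split=> [|M N [a a0 ->] [b b0 ->]|c M c0 [a a0 ->]].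
- by exists (fun=> 0) => //; rewrite big1 // => i _; rewrite scale0r.
- exists (fun i => a i + b i) => [i|]; first exact: addr_ge0.
  by rewrite -big_split /=; apply: eq_bigr => i _; rewrite scalerDl.
- exists (fun i => c * a i) => [i|]; first exact: mulr_ge0.
  by rewrite scaler_sumr; apply: eq_bigr => i _; rewrite scalerA.
Qed.

Lemma simplex_cone_span M : lin_span C M <-> M = \sum_i g i M *: E i.
Proof.
split=> [[k [c [v [Cv ->]]]]|ME].
  have gE j : g j (\sum_i c i *: v i) = \sum_i c i * g j (v i).
    rewrite (scalar_functional_sum (g_lin j)); apply: eq_bigr => i _.
    exact: scalar_functionalZ (g_lin j) _ _.
  under [RHS]eq_bigr do rewrite gE scaler_suml.
  rewrite exchange_big /=; apply: eq_bigr => i _.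
  have [_ vE] := (simplex_coneP (v i)).1 (Cv i).
  by rewrite {1}vE scaler_sumr; apply: eq_bigr => j _; rewrite scalerA.
exists d, (g^~ M), E; split=> // i; exact: simplex_cone_gen.
Qed.

Lemma simplex_cone_dim : cone_dim C d.
Proof.
have [X XE] : exists X : d.-tuple 'M[R]_(p, q), forall i : 'I_d, X`_i = E i.
  by exists [tuple E i | i < d] => i; rewrite -tnth_nth tnth_mktuple.
exists <<X>>%VS.
  apply/seteqP; split=> M.
    move/simplex_cone_span => ->; rewrite /=; apply: memv_suml => i _.
    by apply: memvZ; rewrite -XE; apply/memv_span/mem_nth; rewrite size_tuple.
  move=> /= MX; apply/simplex_cone_span.
  have ME : M = \sum_i coord X i M *: E i.
    by rewrite {1}(coord_span MX); apply: eq_bigr => i _; rewrite XE.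
  by rewrite {1}ME; apply: eq_bigr => i _; rewrite [in RHS]ME dual_sum.
have /eqP : free X.
  apply/freeP => k k0 i.
  have := dual_sum k i; rewrite (_ : \sum_j _ = 0) ?(scalar_functional0 (g_lin i)) //.
  by rewrite -[RHS]k0; apply: eq_bigr => j _; rewrite XE.
by rewrite size_tuple.
Qed.

Lemma simplex_cone_pointed : pointed C.
Proof.
move=> M /simplex_coneP[M0 ME] /simplex_coneP[N0 _].
rewrite ME big1 // => i _; have := N0 i; rewrite -scaleN1r (scalar_functionalZ (g_lin i)).
rewrite mulN1r oppr_ge0 => Mi; have -> : g i M = 0 by apply/eqP; rewrite eq_le Mi M0.
by rewrite scale0r.
Qed.

Lemma simplex_cone_closed : closed C.
Proof.
(* [h] runs over the entries of the defect in the equation for membership; the signs [e = 1] and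
   [e = -1] turn that equation into pairs of closed half-spaces. *)
pose h (e : R) i j M := e * (M - \sum_l g l M *: E l) i j.
have h_lin e i j : scalar (h e i j).
  move=> c u v; rewrite /h.
  have -> : \sum_l g l (c *: u + v) *: E l =
      c *: (\sum_l g l u *: E l) + \sum_l g l v *: E l.
    rewrite scaler_sumr -big_split /=; apply: eq_bigr => l _.
    by rewrite g_lin scalerDl scalerA.
  by rewrite !mxE; ring.
have -> : C = \bigcap_i [set M | 0 <= g i M] `&`
    \bigcap_ij ([set M | 0 <= h 1 ij.1 ij.2 M] `&` [set M | 0 <= h (-1) ij.1 ij.2 M]).
  apply/seteqP; split=> [M /simplex_coneP[M0 ME]|M [/= M0 Mh]].
    split=> [i _|ij _]; first exact: M0.
    by rewrite /h /= -ME subrr mxE !mulr0.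
  apply/simplex_coneP; split=> [i|]; first exact: M0.
  apply/eqP; rewrite -subr_eq0; apply/eqP/matrixP => i j; rewrite [RHS]mxE.
  have [/= h1 h2] := Mh (i, j) I; apply/eqP; rewrite eq_le.
  by move: h1 h2; rewrite /h mul1r mulN1r oppr_ge0 => -> ->.
apply: closedI; apply: closed_bigI => ij _; first exact: closed_scalar_ge0.
by apply: closedI; apply: closed_scalar_ge0.
Qed.

Lemma simplex_cone_relint M :
  relint C M <-> (forall i, 0 < g i M) /\ M = \sum_i g i M *: E i.
Proof.
split=> [[CM Mnbhs]|[M0 ME]].
  have [g0 ME] := (simplex_coneP M).1 CM; split=> // i.
  have [eps e0 le] := nbhs_sub_ray (E i) Mnbhs.
  have /simplex_coneP[/(_ i)] : C (M - eps *: E i).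
    apply: le; apply/simplex_cone_span; rewrite {1}ME.
    under [RHS]eq_bigr do rewrite (scalar_functionalB (g_lin _)) scalerBl.
    rewrite sumrB; congr (_ - _).
    rewrite (bigD1 i) //= big1 => [|j ji].
      by rewrite (scalar_functionalZ (g_lin i)) g_dual eqxx mulr1 addr0.
    by rewrite (scalar_functionalZ (g_lin j)) g_dual (negPf ji) mulr0 scale0r.
  rewrite (scalar_functionalB (g_lin i)) (scalar_functionalZ (g_lin i)) g_dual eqxx mulr1.
  by rewrite subr_ge0 => ge _; exact: lt_le_trans ge.
split; first by apply/simplex_coneP; split=> // i; exact/ltW.
have Ff : Filter (nbhs M) := nbhs_filter M.
have : nbhs M [set N | forall i, 0 < g i N].
  refine (@filter_forall _ _ (fun i => [set N | 0 < g i N]) _ Ff _) => i.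
  exact: nbhs_scalar_gt0.
apply: filterS => N N0 /simplex_cone_span NE; apply/simplex_coneP; split=> // i.
exact/ltW.
Qed.

Lemma ray_scale (c : R) M : 0 < c -> ray (c *: M) = ray M.
Proof.
move=> c0; apply/seteqP; split=> _ [l /= l0 <-].
  by exists (l * c); rewrite /= ?scalerA // mulr_ge0 // ltW.
exists (l / c); first by rewrite /= divr_ge0 // ltW.
by rewrite scalerA divfK // gt_eqF.
Qed.

Lemma simplex_gen_neq0 i : E i != 0.
Proof.
apply/eqP => Ei; have := g_dual i i; rewrite Ei (scalar_functional0 (g_lin i)) eqxx.
by move/eqP; rewrite eq_sym oner_eq0.
Qed.

Lemma simplex_cone_extreme i : extreme_vector C (E i).
Proof.
split; [exact: simplex_gen_neq0|exact: simplex_cone_gen|].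
apply/seteqP; split=> M.
  apply; split; last by move=> _ ->; exists 1; rewrite /= ?ler01 ?scale1r.
  split=> [|_ [l /= l0 <-]|_ N [l /= l0 <-] /simplex_coneP[N0 NE] /simplex_coneP[D0 _]].
  - split=> [|_ _ [l /= l0 <-] [m /= m0 <-]|c _ c0 [l /= l0 <-]].
    + by exists 0; rewrite /= ?scale0r.
    + by exists (l + m); rewrite /= ?scalerDl ?addr_ge0.
    + by exists (c * l); rewrite /= ?scalerA ?mulr_ge0.
  - by have [_ _ CZ] := simplex_cone_convex; apply: CZ => //; exact: simplex_cone_gen.
  exists (g i N); first exact: N0.
  rewrite [RHS]NE (bigD1 i) //= big1 ?addr0 // => j ji.
  have := D0 j; rewrite (scalar_functionalB (g_lin j)) (scalar_functionalZ (g_lin j)).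
  rewrite g_dual (negPf ji) mulr0 sub0r oppr_ge0 => Nj.
  by have -> : g j N = 0; [apply/eqP; rewrite eq_le Nj N0|rewrite scale0r].
move=> [l /= l0 <-] F [[[_ _ FZ] _ _] FE]; apply: FZ => //; exact: FE.
Qed.

Lemma simplex_extreme_ray M : extreme_vector C M -> exists i, ray M = ray (E i).
Proof.
move=> [M_neq0 CM PhiM]; have [M0 ME] := (simplex_coneP M).1 CM.
have [i Mi] : exists i, 0 < g i M.
  apply: contrapT => /forallNP nM; move/eqP: M_neq0; apply.
  rewrite ME big1 // => i _; have /negP := nM i; rewrite -leNgt => Mi.
  by have -> : g i M = 0; [apply/eqP; rewrite eq_le Mi M0|rewrite scale0r].
(* [g i M *: E i] lies below [M] in the cone order, so it belongs to the smallest face containing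
   [M], which is a ray. *)
have : Phi C M (g i M *: E i).
  move=> F [[Fcone FC Fface] FM]; apply: (Fface M); first exact: FM.
    by have [_ _ CZ] := simplex_cone_convex; apply: CZ => //; exact: simplex_cone_gen.
  rewrite {1}ME (bigD1 i) //= addrAC subrr add0r.
  have [C0 CD CZ] := simplex_cone_convex.
  elim/big_ind: _ => // j _; apply: CZ => //; exact: simplex_cone_gen.
rewrite PhiM => -[l /= l0 lM]; exists i.
have l_gt0 : 0 < l.
  rewrite lt_neqAle l0 andbT; apply/eqP => l0'; have := congr1 (g i) lM.
  rewrite -l0' scale0r (scalar_functional0 (g_lin i)) (scalar_functionalZ (g_lin i)).
  by rewrite g_dual eqxx mulr1 => gM; rewrite -gM ltxx in Mi.
by rewrite -(ray_scale M l_gt0) lM ray_scale.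
Qed.

Lemma simplex_cone_rays : extreme_rays C = [set ray (E i) | i in [set: 'I_d]].
Proof.
apply/seteqP; split=> [_ [M /simplex_extreme_ray[i Mi] <-]|_ [i _ <-]].
  by exists i.
by exists (E i) => //; exact: simplex_cone_extreme.
Qed.

Lemma simplex_cone_card_rays : (extreme_rays C #= `I_d)%card.
Proof.
rewrite simplex_cone_rays.
have inj : {in [set: 'I_d] &, injective (fun i => ray (E i))}.
  move=> i j _ _ eq; have : ray (E i) (E i) by exists 1; rewrite /= ?ler01 ?scale1r.
  rewrite eq => -[l _ lE]; apply/eqP; rewrite eq_sym; apply/negPn/negP => ji.
  have := congr1 (g i) lE; rewrite (scalar_functionalZ (g_lin i)) !g_dual eqxx.
  by rewrite eq_sym (negPf ji) mulr0 => /eqP; rewrite eq_sym oner_eq0.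
have /card_eq_trans := inj_card_eq inj; apply.
have valI : [set val i | i in [set: 'I_d]] = `I_d.
  by apply/seteqP; split=> [_ [i _ <-] /=|k /= kd]; [exact: ltn_ord|exists (Ordinal kd)].
have : ([set val i | i in [set: 'I_d]] #= [set: 'I_d])%card.
  by apply: inj_card_eq => i j _ _; exact: val_inj.
by rewrite valI card_eq_sym.
Qed.

Lemma simplex_cone_simplicial : simplicial_cone C.
Proof.
split; last by exists d; [exact: simplex_cone_dim|exact: simplex_cone_card_rays].
split; last first.
  by exists d; exact: simplex_cone_card_rays.
split; [exact: simplex_cone_convex|exact: simplex_cone_closed|exact: simplex_cone_pointed|].
exists (\sum_i 1 *: E i); apply/simplex_cone_relint; split=> [i|].
  by rewrite dual_sum.
by apply: eq_bigr => i _; rewrite dual_sum.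
Qed.

End SimplicialCone.

(** * Facets of the minimal cone *)

(* Indices are shifted by one: [X v] stands for the extreme vector [x_(v+1)], and
   [rel_coef v] is its coefficient in the linear relation, so the summand
   [pos {x_2}] corresponds to [v = 1]. *)
Definition rel_coef (R : realType) (v : nat) : R :=
  match v with 0%N => 1 | 1%N => 0 | _ => (-1) ^+ v.+1 end.

Section Relation.
Variable R : realType.
Local Notation r := (@rel_coef R).

Lemma rel_coefS v : (2 <= v)%N -> r v.+1 = - r v.
Proof. by case: v => [|[|v]] // _; rewrite /rel_coef exprS mulN1r. Qed.

Lemma rel_coef_cases v : v <> 1%N -> r v = 1 \/ r v = -1.
Proof.
case: v => [|[|v]] // _; first by left.
by rewrite /rel_coef -signr_odd; case: (odd _); [right|left].
Qed.

Lemma rel_coef_neq0 v : v <> 1%N -> r v != 0.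
Proof. by case/rel_coef_cases => ->; rewrite ?oppr_eq0 oner_eq0. Qed.

Lemma rel_coef2 : r 2 = -1.
Proof. by rewrite /rel_coef; ring. Qed.

Lemma rel_coef_even v : (2 <= v)%N -> ~~ odd v -> r v = -1.
Proof.
case: v => [|[|v]] // _ ev; rewrite /rel_coef -signr_odd.
by rewrite (_ : odd _ = true) ?expr1 //; move: ev => /=; rewrite negbK => ->.
Qed.

End Relation.

Lemma mul_col_sum (R : realType) p m (M : 'M[R]_(m, p)) (c : 'cV[R]_p) :
  M *m c = \sum_v c v 0 *: col v M.
Proof.
apply/matrixP => i j; rewrite !mxE summxE ord1.
by apply: eq_bigr => k _; rewrite !mxE mulrC.
Qed.

(** This distils the hypotheses on the minimal cone: generators, a relation among them, and
    spanning. Since [n + 1] vectors span dimension [n], every relation is a multiple of the given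
    one. *)
Definition fan (R : realType) (n : nat) (K : set 'cV[R]_n)
    (X : 'I_n.+1 -> 'cV[R]_n) : Prop :=
  [/\ (4 <= n)%N, ~~ odd n,
      forall y, K y <-> exists2 c : 'I_n.+1 -> R,
        forall v, 0 <= c v & y = \sum_v c v *: X v,
      \sum_(v < n.+1) rel_coef R v *: X v = 0 &
      forall y, exists c : 'I_n.+1 -> R, y = \sum_v c v *: X v].

Section Fan.
Variables (R : realType) (n : nat) (K : set 'cV[R]_n) (X : 'I_n.+1 -> 'cV[R]_n).
Hypothesis X_fan : fan K X.
Local Notation r := (@rel_coef R).

Lemma fan_n_ge4 : (4 <= n)%N. Proof. by case: X_fan. Qed.

Lemma fan_n_even : ~~ odd n. Proof. by case: X_fan. Qed.

Lemma fan_pos y : K y <-> exists2 c : 'I_n.+1 -> R,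
  forall v, 0 <= c v & y = \sum_v c v *: X v.
Proof. by case: X_fan. Qed.

Lemma fan_rel : \sum_(v < n.+1) r v *: X v = 0. Proof. by case: X_fan. Qed.

Lemma fan_span y : exists c : 'I_n.+1 -> R, y = \sum_v c v *: X v.
Proof. by case: X_fan. Qed.

Let n_ge4 := fan_n_ge4.
Let n_even := fan_n_even.
Implicit Types (c : 'I_n.+1 -> R) (y z : 'cV[R]_n) (A B : 'M[R]_n).
Local Notation o := (@inord n).

(** As [n] is even, the last extreme vector has coefficient [-1] in the relation, so the other [n]
    already span and form a basis. *)
Lemma fan_basis : exists L : 'M[R]_n,
  (\matrix_(i, j < n) X (widen_ord (leqnSn n) j) i 0) *m L = 1%:M /\
  L *m (\matrix_(i, j < n) X (widen_ord (leqnSn n) j) i 0) = 1%:M.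
Proof.
set M := (\matrix_(i, j) _).
have colM j : col j M = X (widen_ord (leqnSn n) j).
  by apply/matrixP => i k; rewrite !mxE ord1.
have span y : exists u : 'cV[R]_n, M *m u = y.
  have [c ->] := fan_span y.
  exists (\col_j (c (widen_ord (leqnSn n) j) + c ord_max * r j)).
  rewrite mul_col_sum big_ord_recr /=.
  have -> : X ord_max = \sum_(j < n) r j *: X (widen_ord (leqnSn n) j).
    move: fan_rel; rewrite big_ord_recr /= rel_coef_even //; last lia.
    by rewrite scaleN1r => /eqP; rewrite subr_eq0 => /eqP ->.
  rewrite scaler_sumr -big_split /=; apply: eq_bigr => j _.
  by rewrite colM mxE scalerDl scalerA.
have [f fE] := choice (fun j => span (delta_mx j 0)).
have ML : M *m (\matrix_(i, j) f j i 0) = 1%:M.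
  apply/matrixP => i j; have /matrixP/(_ i 0) := fE j.
  rewrite !mxE eqxx andbT => <-; apply: eq_bigr => k _; by rewrite !mxE.
by exists (\matrix_(i, j) f j i 0); split => //; apply: mulmx1C.
Qed.

Lemma fan_kernel c : \sum_v c v *: X v = 0 -> exists l, forall v, c v = l * r v.
Proof.
move=> c0; exists (- c ord_max) => v; apply/eqP; rewrite -subr_eq0; apply/eqP.
pose d v := c v - - c ord_max * r v; rewrite -/(d v).
have d0 : \sum_v d v *: X v = 0.
  rewrite /d; under eq_bigr do rewrite scalerBl -scalerA.
  by rewrite sumrB c0 -scaler_sumr fan_rel scaler0 subr0.
have dmax : d ord_max = 0 by rewrite /d rel_coef_even //=; [ring|lia].
have [L [_ LM]] := fan_basis.
set M := (\matrix_(i, j) _) in LM.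
have : M *m (\col_j d (widen_ord (leqnSn n) j)) = 0.
  move: d0; rewrite mul_col_sum big_ord_recr /= dmax scale0r addr0 => d0.
  rewrite -[RHS]d0; apply: eq_bigr => j _; rewrite mxE; congr (_ *: _).
  by apply/matrixP => i k; rewrite !mxE ord1.
move=> /(congr1 (mulmx L)); rewrite mulmxA LM mul1mx mulmx0 => /matrixP dE.
case: (unliftP ord_max v) => [j ->|-> //].
have := dE j 0; rewrite !mxE => <-; congr d.
by apply/val_inj; rewrite /= /bump leqNgt ltn_ord.
Qed.

(** One choice of coordinates among many, but a linear one, which makes each [facet] a linear
    functional. *)
Lemma fan_coord : exists L : 'M[R]_(n.+1, n),
  forall y, y = \sum_v (L *m y) v 0 *: X v.
Proof.
have [f fE] := choice (fun j : 'I_n => fan_span (delta_mx j 0)).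
pose M := \matrix_(i, v) X v i 0; pose L := \matrix_(v, j) f j v.
exists L => y.
have ML : M *m L = 1%:M.
  apply/matrixP => i j; have /matrixP/(_ i 0) := fE j.
  rewrite !mxE eqxx andbT summxE => ->.
  by apply: eq_bigr => v _; rewrite !mxE mulrC.
rewrite -{1}[y]mul1mx -ML -mulmxA mul_col_sum; apply: eq_bigr => v _.
by congr (_ *: _); apply/matrixP => i k; rewrite !mxE ord1.
Qed.

(* In coordinates [c], unique up to multiples of the relation, the facets of [K]
   are [c_1 = 0] and [c_p + c_q = 0] for [p], [q] on opposite sides of the
   relation. *)
Definition facet_pair (p q : 'I_n.+1) := (p == o 1) || (r p == 1) && (r q == -1).

Definition facet_coef (p q : 'I_n.+1) c := if p == o 1 then c p else c p + c q.

Definition facet p q y := facet_coef p q (fun v => (sval (cid fan_coord) *m y) v 0).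

Lemma val_o k : (k <= n)%N -> o k = k :> nat.
Proof. by move=> kn; rewrite inordK. Qed.

Lemma eq_o k v : (k <= n)%N -> (v == o k) = (v == k :> nat).
Proof. by move=> kn; rewrite -val_eqE /= val_o. Qed.

Lemma facet_coef_rel p q : facet_pair p q -> facet_coef p q (fun v => r v) = 0.
Proof.
rewrite /facet_pair /facet_coef; case: eqP => [-> _|_ /andP[/eqP -> /eqP ->]].
  by rewrite val_o //; lia.
by rewrite subrr.
Qed.

Lemma facet_coefD p q c c' :
  facet_coef p q (fun v => c v + c' v) = facet_coef p q c + facet_coef p q c'.
Proof. by rewrite /facet_coef; case: eqP => // _; ring. Qed.

Lemma facet_coefZ p q a c :
  facet_coef p q (fun v => a * c v) = a * facet_coef p q c.
Proof. by rewrite /facet_coef; case: eqP => // _; ring. Qed.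

(** Two coordinate vectors of the same point differ by a multiple of the relation, where
    [facet_coef] vanishes; so the choice hidden in [facet] is immaterial. *)
Lemma facet_sum p q c : facet_pair p q ->
  facet p q (\sum_v c v *: X v) = facet_coef p q c.
Proof.
move=> pq; rewrite /facet; case: cid => L /= Lc.
set y := \sum_v c v *: X v.
have [l lE] : exists l, forall v, (L *m y) v 0 - c v = l * r v.
  apply: fan_kernel; under eq_bigr do rewrite scalerBl.
  by rewrite sumrB -Lc subrr.
have -> : (fun v => (L *m y) v 0) = (fun v => c v + l * r v).
  by apply/funext => v; rewrite -lE addrC subrK.
by rewrite facet_coefD facet_coefZ facet_coef_rel // mulr0 addr0.
Qed.

Lemma facet_scalar p q : scalar (facet p q).
Proof.
move=> a u v; rewrite /facet -facet_coefZ -facet_coefD; congr facet_coef.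
by apply/funext => w; rewrite mulmxDr -scalemxAr !mxE.
Qed.

Lemma facetZ p q a y : facet p q (a *: y) = a * facet p q y.
Proof. exact: scalar_functionalZ (facet_scalar p q) _ _. Qed.

Lemma facetD p q y z : facet p q (y + z) = facet p q y + facet p q z.
Proof. exact: scalar_functionalD (facet_scalar p q) _ _. Qed.

Lemma facetB p q y z : facet p q (y - z) = facet p q y - facet p q z.
Proof. exact: scalar_functionalB (facet_scalar p q) _ _. Qed.

Lemma facet0 p q : facet p q 0 = 0.
Proof. exact: scalar_functional0 (facet_scalar p q). Qed.

Lemma X_delta v : X v = \sum_w (w == v)%:R *: X w.
Proof.
rewrite (bigD1 v) //= eqxx scale1r big1 ?addr0 // => w /negPf ->.
by rewrite scale0r.
Qed.

Lemma facet_X p q v : facet_pair p q ->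
  facet p q (X v) = facet_coef p q (fun w => (w == v)%:R).
Proof. by move=> pq; rewrite {1}X_delta facet_sum. Qed.

(** For the converse, let [c p0] be the least coefficient on the positive side of the relation.
    Subtracting [c p0] times the relation makes that side nonnegative, and on the other side the new
    coefficient [c v + c p0] is itself a facet value. *)
Lemma K_facet y : K y <-> forall p q, facet_pair p q -> 0 <= facet p q y.
Proof.
split=> [/fan_pos[c c0 ->] p q pq|yf].
  by rewrite facet_sum // /facet_coef; case: eqP => // _; apply: addr_ge0.
have [c yE] := fan_span y.
have yc p q : facet_pair p q -> 0 <= facet_coef p q c.
  by move=> pq; rewrite -facet_sum // -yE; apply: yf.
have r0 : r (o 0) == 1 by rewrite val_o.
case: (@arg_minP _ R _ _ (fun v : 'I_n.+1 => r v == 1) c r0) => p0 /eqP rp0 p0_min.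
apply/fan_pos; exists (fun v => c v - c p0 * r v) => [v|]; last first.
  rewrite yE; apply/esym; under eq_bigr do rewrite scalerBl -scalerA.
  by rewrite sumrB -scaler_sumr fan_rel scaler0 subr0.
have p0o : p0 == o 1 = false.
  by apply/negbTE/negP => /eqP p01; move: rp0;
    rewrite p01 val_o /= ?(oner_eq0) => [/eqP|]; rewrite 1?eq_sym ?oner_eq0 //; lia.
have [vo|vo] := eqVneq v (o 1).
  have := @yc (o 1) (o 1); rewrite /facet_pair /facet_coef vo eqxx => /(_ isT).
  by rewrite val_o /= ?mulr0 ?subr0 //; lia.
have : v <> 1%N :> nat by apply/eqP; rewrite -eq_o //; lia.
case/(rel_coef_cases R) => rv; rewrite rv.
  by rewrite mulr1 subr_ge0 p0_min // rv.
have := @yc p0 v; rewrite /facet_pair /facet_coef p0o rp0 rv !eqxx => /(_ isT).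
by rewrite mulrN1 opprK addrC.
Qed.

Lemma facet_int y : interior K y <-> forall p q, facet_pair p q -> 0 < facet p q y.
Proof.
split=> [yK p q pq|yf].
  have [eps eps0 /K_facet/(_ p q pq)] := nbhs_sub_ray (\sum_v 1 *: X v) yK.
  rewrite facetB facetZ facet_sum // subr_ge0; apply: lt_le_trans.
  by rewrite mulr_gt0 // /facet_coef; case: eqP.
rewrite /interior /=.
have yFf : Filter (nbhs y) := nbhs_filter y.
have : nbhs y [set z | forall p q, facet_pair p q -> 0 < facet p q z].
  refine (@filter_forall _ _ (fun p =>
    [set z | forall q, facet_pair p q -> 0 < facet p q z]) _ yFf _) => p.
  refine (@filter_forall _ _ (fun q =>
    [set z | facet_pair p q -> 0 < facet p q z]) _ yFf _) => q.
  have [pq|npq] := boolP (facet_pair p q); last exact: nearW.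
  apply: filterS (nbhs_scalar_gt0 (facet_scalar p q) (yf p q pq)).
  by move=> z zf _.
apply: filterS => z zf; apply/K_facet => p q pq; exact/ltW/zf.
Qed.

Lemma facet_X_eq0 v : exists p q, facet_pair p q /\ facet p q (X v) = 0.
Proof.
have [->|vo] := eqVneq v (o 1); last first.
  exists (o 1), (o 1); have pq : facet_pair (o 1) (o 1) by rewrite /facet_pair eqxx.
  by split=> //; rewrite facet_X // /facet_coef eqxx eq_sym (negPf vo).
have pq : facet_pair (o 0) (o 2).
  by rewrite /facet_pair !val_o ?rel_coef2 ?eqxx ?orbT //; lia.
exists (o 0), (o 2); split => //; rewrite facet_X // /facet_coef.
by rewrite !eq_o ?val_o /= ?addr0 //; lia.
Qed.

Lemma facet_X_eq1 p q : facet_pair p q -> facet p q (X p) = 1.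
Proof.
move=> pq; rewrite facet_X // /facet_coef eqxx; case: eqP => // po.
move: pq; rewrite /facet_pair; case: eqP => //= _ /andP[/eqP rp /eqP rq].
case: eqP => [qp|_]; last by rewrite addr0.
by move: rq; rewrite qp rp => ?; lra.
Qed.

End Fan.

(** * Powers of cone-preserving matrices *)

Lemma mulmx_exprD (R : realType) n (B : 'M[R]_n) k l (y : 'cV[R]_n) :
  B ^+ (k + l) *m y = B ^+ k *m (B ^+ l *m y).
Proof. by rewrite exprD -[B ^+ k * _]/(_ *m _) mulmxA. Qed.

Lemma mulmx_exprS (R : realType) n (B : 'M[R]_n) k (y : 'cV[R]_n) :
  B ^+ k.+1 *m y = B *m (B ^+ k *m y).
Proof. by rewrite exprS -[B * _]/(_ *m _) mulmxA. Qed.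

Lemma mulmx_expr0 (R : realType) n (B : 'M[R]_n) (y : 'cV[R]_n) : B ^+ 0 *m y = y.
Proof. by rewrite expr0 -[1]/(1%:M) mul1mx. Qed.

Lemma mulmx_exprM (R : realType) n (B : 'M[R]_n) s k (y : 'cV[R]_n) :
  (B ^+ s) ^+ k *m y = B ^+ (s * k) *m y.
Proof. by rewrite exprM. Qed.

Lemma matrix_power_span (R : realType) n (C : 'M[R]_n) N : (0 < n)%N ->
  exists h : 'I_n -> R, C ^+ N = \sum_(j < n) h j *: C ^+ j.
Proof.
case: n C => // n C _; pose q := char_poly C; pose m := ('X^N %% q)%R.
have q0 : q != 0 by rewrite -size_poly_eq0 size_char_poly.
have sm : (size m <= n.+1)%N.
  by have := ltn_modp ('X^N) q; rewrite q0 size_char_poly ltnS.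
exists (fun j => m`_j).
have -> : C ^+ N = horner_mx C m.
  have := congr1 (horner_mx C) (divp_eq 'X^N q).
  by rewrite rmorphD rmorphM /= Cayley_Hamilton mulr0 add0r rmorphXn /= horner_mx_X.
rewrite -{1}(coefK m) poly_def (big_ord_widen n.+1 (fun i => m`_i *: 'X^i)) //.
rewrite linear_sum big_mkcond /=; apply: eq_bigr => j _.
case: ltnP => [_|/(nth_default 0) ->]; last by rewrite scale0r.
by rewrite linearZ /= rmorphXn /= horner_mx_X.
Qed.

Section FanMaps.
Variables (R : realType) (n : nat) (K : set 'cV[R]_n) (X : 'I_n.+1 -> 'cV[R]_n).
Hypothesis X_fan : fan K X.
Let n_ge4 := fan_n_ge4 X_fan.
Implicit Types (y z : 'cV[R]_n) (B C : 'M[R]_n).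

Lemma fan_K0 : K 0.
Proof. by apply/(K_facet X_fan) => p q _; rewrite facet0. Qed.

Lemma fan_KD y z : K y -> K z -> K (y + z).
Proof.
move=> /(K_facet X_fan) yf /(K_facet X_fan) zf; apply/(K_facet X_fan) => p q pq.
by rewrite facetD addr_ge0 ?yf ?zf.
Qed.

Lemma fan_KZ a y : 0 <= a -> K y -> K (a *: y).
Proof.
move=> a0 /(K_facet X_fan) yf; apply/(K_facet X_fan) => p q pq.
by rewrite facetZ mulr_ge0 ?yf.
Qed.

Lemma fan_KX v : K (X v).
Proof.
apply/(fan_pos X_fan); exists (fun w => (w == v)%:R) => [w|]; first exact: ler0n.
exact: X_delta.
Qed.

Lemma fan_K_sum I (s : seq I) (P : pred I) (F : I -> 'cV[R]_n) :
  (forall i, P i -> K (F i)) -> K (\sum_(i <- s | P i) F i).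
Proof. by move=> KF; elim/big_ind: _ => //; [exact: fan_K0 | exact: fan_KD]. Qed.

Lemma fan_int_K y : interior K y -> K y.
Proof. exact: nbhs_singleton. Qed.

Lemma fan_intD y z : interior K y -> K z -> interior K (y + z).
Proof.
move=> /(facet_int X_fan) yf /(K_facet X_fan) zf; apply/(facet_int X_fan) => p q pq.
by rewrite facetD ltr_wpDr ?yf ?zf.
Qed.

Lemma fan_intZ a y : 0 < a -> interior K y -> interior K (a *: y).
Proof.
move=> a0 /(facet_int X_fan) yf; apply/(facet_int X_fan) => p q pq.
by rewrite facetZ mulr_gt0 ?yf.
Qed.

Lemma fan_int_ge y z a : 0 < a -> K (y - a *: z) -> interior K z -> interior K y.
Proof. by move=> a0 yz zi; rewrite -(subrK (a *: z) y) addrC; apply: fan_intD;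
  [exact: fan_intZ|]. Qed.

Lemma fan_extreme_not_int a v : ~ interior K (a *: X v).
Proof.
move=> /(facet_int X_fan) af; have [p [q [pq X0]]] := facet_X_eq0 X_fan v.
by have := af p q pq; rewrite facetZ X0 mulr0 ltxx.
Qed.

Lemma fan_pi B : pi_cone K B <-> forall v, K (B *m X v).
Proof.
split=> [KB v|KB y /(fan_pos X_fan)[c c0 ->]]; first exact/KB/fan_KX.
rewrite mulmx_sumr; apply: fan_K_sum => v _; rewrite -scalemxAr.
exact: fan_KZ.
Qed.

Lemma pi_exp B k : pi_cone K B -> pi_cone K (B ^+ k).
Proof.
move=> KB y Ky; elim: k => [|k IHk]; first by rewrite mulmx_expr0.
by rewrite mulmx_exprS; apply: KB.
Qed.

Definition dominates B k y z := exists2 eps : R, 0 < eps & K (B ^+ k *m y - eps *: z).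

Lemma dominates_trans B k l x y z : pi_cone K B ->
  dominates B k x y -> dominates B l y z -> dominates B (k + l) x z.
Proof.
move=> KB [a a0 xy] [b b0 yz]; exists (a * b); first exact: mulr_gt0.
have := fan_KD (pi_exp l KB xy) (fan_KZ (ltW a0) yz).
by rewrite mulmxBr scalerBr addrA -scalemxAr subrK scalerA -mulmx_exprD addnC.
Qed.

Lemma dominates_iter B s k x : pi_cone K B ->
  dominates B s x x -> dominates B (s * k) x x.
Proof.
move=> KB xx; elim: k => [|k IHk].
  exists 1; rewrite ?ltr01 // muln0 mulmx_expr0 scale1r subrr; exact: fan_K0.
by rewrite mulnS; apply: dominates_trans IHk.
Qed.

(* The facets that vanish at [C^(n-1) x] vanish at all [C^j x] with [j < n],
   hence, by Cayley-Hamilton, on the whole orbit of [x]. *)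
Lemma dominates_chain C x N : pi_cone K C -> K x -> dominates C 1 x x ->
  interior K (C ^+ N *m x) -> interior K (C ^+ n.-1 *m x).
Proof.
move=> KC Kx xx /(facet_int X_fan) CN; apply/(facet_int X_fan) => p q pq.
have ge0 k : 0 <= facet X_fan p q (C ^+ k *m x).
  by move: pq; apply/(K_facet X_fan): (p) (q); apply: pi_exp.
rewrite lt_neqAle ge0 andbT eq_sym; apply/negP => /eqP C0.
have := CN p q pq; have [h ->] := matrix_power_span C N (ltac:(lia) : (0 < n)%N).
rewrite mulmx_suml (scalar_functional_sum (facet_scalar X_fan p q)).
rewrite big1 ?ltxx // => j _; rewrite -scalemxAl facetZ.
suff -> : facet X_fan p q (C ^+ j *m x) = 0 by rewrite mulr0.
have [eps e0 le] := dominates_iter (n.-1 - j) KC xx.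
apply/eqP; rewrite eq_le ge0 andbT -(pmulr_rle0 _ e0).
have := pi_exp j KC le; rewrite mulmxBr -scalemxAr -mulmx_exprD mul1n subnKC.
  by move/(K_facet X_fan)/(_ p q pq); rewrite facetB facetZ C0 sub0r oppr_ge0.
by have := ltn_ord j; lia.
Qed.

Lemma int_neq0 y : interior K y -> y != 0.
Proof.
move=> yi; apply/eqP => y0; apply: (@fan_extreme_not_int 0 ord0).
by rewrite scale0r -y0.
Qed.

Lemma primitive_neq0 B y : primitive K B -> K y -> y != 0 -> B *m y != 0.
Proof.
move=> [_ [[//|p] _ Bp]] Ky y0; apply/negP => /eqP By0.
have /int_neq0/eqP := Bp _ Ky y0; apply.
by rewrite -[p.+1]addn1 mulmx_exprD expr1 By0 mulmx0.
Qed.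

Lemma primitive_exp_neq0 B k y : primitive K B -> K y -> y != 0 ->
  B ^+ k *m y != 0.
Proof.
move=> pB Ky y0; elim: k => [|k IHk]; first by rewrite mulmx_expr0.
rewrite mulmx_exprS; apply: primitive_neq0 => //; apply: pi_exp Ky.
by case: pB.
Qed.

Lemma X_neq0 v : X v != 0.
Proof.
apply/eqP => X0.
have [l lE] : exists l, forall w, (w == v)%:R = l * rel_coef R w.
  by apply: (fan_kernel X_fan); rewrite -X_delta.
have l0 : l = 0.
  apply/eqP; rewrite eq_le; apply/andP; split.
    have := ler0n R (inord 2 == v); rewrite lE val_o //; last lia.
    by rewrite rel_coef2 mulrN1 oppr_ge0.
  have := ler0n R (inord 0 == v); rewrite lE val_o //.
  by rewrite mulr1.
by have /eqP := lE v; rewrite eqxx l0 mul0r oner_eq0.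
Qed.

End FanMaps.

(** * The digraph of a primitive matrix *)

Section FanDigraph.
Variables (R : realType) (n : nat) (K : set 'cV[R]_n) (X : 'I_n.+1 -> 'cV[R]_n).
Hypothesis X_fan : fan K X.
Let n_ge4 := fan_n_ge4 X_fan.
Implicit Types (y z : 'cV[R]_n) (B C : 'M[R]_n).

Lemma maps_into_interiorP C : maps_into_interior K C <-> forall v, interior K (C *m X v).
Proof.
split=> [CK v|CX y /(fan_pos X_fan)[c c0 ->] y0].
  by apply: CK; [exact: (fan_KX X_fan)|exact: (X_neq0 X_fan)].
have [v cv] : exists v, 0 < c v.
  apply: contrapT => /forallNP nc; move/eqP: y0; apply.
  apply: big1 => v _; have /negP := nc v.
  rewrite -leNgt => c0'; have -> : c v = 0 by apply/eqP; rewrite eq_le c0 c0'.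
  by rewrite scale0r.
rewrite mulmx_sumr (bigD1 v) //=; apply: (fan_intD X_fan) => //.
  by rewrite -scalemxAr; apply: (fan_intZ X_fan).
apply: (fan_K_sum X_fan) => w _; rewrite -scalemxAr; apply: (fan_KZ X_fan) => //.
exact: fan_int_K (CX w).
Qed.

Lemma primitive_late B : primitive K B -> exists p, forall m y, (p <= m)%N ->
  K y -> y != 0 -> interior K (B ^+ m *m y).
Proof.
move=> pB; have [KB [p _ Bp]] := pB; exists p => m y pm Ky y0.
rewrite -(subnKC pm) mulmx_exprD; apply: Bp; first exact: (pi_exp _ KB).
exact: (primitive_exp_neq0 X_fan).
Qed.

(** An interior [y] exceeds a small multiple of [B ^+ p *m X ord0], and [B] sends the latter to
    [B ^+ p.+1 *m X ord0], which is interior because [p] is late enough. *)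
Lemma primitive_int B k y : primitive K B -> interior K y -> interior K (B ^+ k *m y).
Proof.
move=> pB yi; have [KB _] := pB; elim: k => [|k IHk]; first by rewrite mulmx_expr0.
rewrite mulmx_exprS; move: (B ^+ k *m y) IHk => {yi}y yi.
have [p pint] := primitive_late pB.
have [eps e0 le] := nbhs_sub_ray (B ^+ p *m X ord0) yi.
apply: (fan_int_ge X_fan e0 (z := B ^+ p.+1 *m X ord0)); last first.
  by apply: pint; rewrite ?leqnSn //; [exact: (fan_KX X_fan)|exact: (X_neq0 X_fan)].
by have := KB _ le; rewrite mulmxBr -scalemxAr -mulmx_exprS.
Qed.

(** Taken from the order of [K] and not from coefficients: it means that some nonnegative
    representation of [B *m X v] has a positive coefficient at [w]. *)
Definition edge B : rel 'I_n.+1 := fun v w => `[< dominates K B 1 (X v) (X w) >].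

Lemma walk_dominates B k v w : pi_cone K B -> walk (edge B) k v w ->
  dominates K B k (X v) (X w).
Proof.
move=> KB [p [ep <- <-]]; elim: p v ep => [|u p IHp] v /=.
  move=> _; exists 1; rewrite ?ltr01 // mulmx_expr0 scale1r subrr.
  exact: (fan_K0 X_fan).
move=> /andP[/asboolP vu /IHp up]; rewrite -add1n.
exact: (dominates_trans X_fan KB vu up).
Qed.

(** For each [u] there is a nonnegative representation that is positive at [u] whenever the edge to
    [u] exists; the average over all [u] realises every edge at once. *)
Lemma edge_coef B : pi_cone K B -> exists b : 'I_n.+1 -> 'I_n.+1 -> R,
  [/\ forall v w, 0 <= b v w, forall v, B *m X v = \sum_w b v w *: X w &
      forall v w, edge B v w = (0 < b v w)].
Proof.
move=> KB.
suff row v : exists c : 'I_n.+1 -> R, [/\ forall w, 0 <= c w,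
    B *m X v = \sum_w c w *: X w & forall w, edge B v w = (0 < c w)].
  have [b bP] := choice row; exists b.
  by split=> [v w|v|v w]; have [? ? ?] := bP v.
have rep u : exists c : 'I_n.+1 -> R, [/\ forall w, 0 <= c w,
    B *m X v = \sum_w c w *: X w & edge B v u -> 0 < c u].
  have [/asboolP [eps e0 /(fan_pos X_fan)[c c0 cE]]|nuv] := boolP (edge B v u).
    exists (fun w => c w + eps * (w == u)%:R); split=> [w||_].
    - by rewrite addr_ge0 // mulr_ge0 ?ler0n // ltW.
    - under eq_bigr do rewrite scalerDl -scalerA.
      by rewrite big_split /= -cE -scaler_sumr -X_delta expr1 subrK.
    - by rewrite eqxx mulr1 ltr_wpDl.
  have /(fan_pos X_fan)[c c0 cE] := KB _ (fan_KX X_fan v).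
  by exists c; split=> // uv; move/negP: nuv.
have [f fP] := choice rep.
have nz : n.+1%:R != 0 :> R by rewrite pnatr_eq0.
pose c w := n.+1%:R^-1 * \sum_u f u w.
have c_ge0 w : 0 <= c w.
  by rewrite mulr_ge0 ?invr_ge0 ?ler0n // sumr_ge0 // => u _; have [] := fP u.
have cE : B *m X v = \sum_w c w *: X w.
  under eq_bigr do rewrite -scalerA scaler_suml.
  rewrite -scaler_sumr exchange_big /= (eq_bigr (fun _ => B *m X v)) => [|u _].
    by rewrite sumr_const card_ord -(scaler_nat _ (B *m X v)) scalerA mulVf ?scale1r.
  by have [_ <-] := fP u.
exists c; split=> // w; apply/idP/idP => [vw|cw].
  rewrite mulr_gt0 ?invr_gt0 ?ltr0n // (bigD1 w) //= ltr_wpDr //.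
    by apply: sumr_ge0 => u _; have [] := fP u.
  by have [_ _] := fP w; apply.
apply/asboolP; exists (c w) => //; rewrite expr1 cE (bigD1 w) //= addrAC subrr add0r.
by apply: (fan_K_sum X_fan) => u _; apply: (fan_KZ X_fan); [|exact: (fan_KX X_fan)].
Qed.

Section Labelling.
Variable B : 'M[R]_n.
Hypothesis B_primitive : primitive K B.
Let KB : pi_cone K B. Proof. by case: B_primitive. Qed.

Lemma edge_out v : exists w, edge B v w.
Proof.
have [b [b0 bE be]] := edge_coef KB; apply: contrapT => /forallNP nb.
have /eqP := primitive_neq0 X_fan B_primitive (fan_KX X_fan v) (X_neq0 X_fan v).
apply; rewrite bE big1 // => w _; have /negP := nb w; rewrite be -leNgt => b0'.
by have -> : b v w = 0; [apply/eqP; rewrite eq_le b0' b0|rewrite scale0r].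
Qed.

(** The orbit of [X t] would stay on extreme rays, none of which meets the interior. *)
Lemma edge_no_rotation (T : {set 'I_n.+1}) : T != finset.set0 ->
  (forall t, t \in T -> exists2 u, u \in T & forall w, edge B t w -> w = u) -> False.
Proof.
move=> /set0Pn[t tT] TP; have [b [b0 bE be]] := edge_coef KB.
have step u : u \in T -> exists a w, w \in T /\ B *m X u = a *: X w.
  move=> /TP[w wT uw]; exists (b u w), w; split=> //.
  rewrite bE (bigD1 w) //= big1 ?addr0 // => w' w'w.
  have -> : b u w' = 0; last by rewrite scale0r.
  apply/eqP; rewrite eq_le b0 andbT leNgt -be; apply/negP => /uw eq.
  by rewrite eq eqxx in w'w.
have orb k : exists a w, w \in T /\ B ^+ k *m X t = a *: X w.
  elim: k => [|k [a [w [wT IHk]]]].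
    by exists 1, t; rewrite mulmx_expr0 scale1r.
  have [a' [w' [w'T E]]] := step w wT; exists (a * a'), w'; split=> //.
  by rewrite mulmx_exprS IHk -scalemxAr E scalerA.
have [p pint] := primitive_late B_primitive.
have [a [w [_ E]]] := orb p.
apply: (fan_extreme_not_int X_fan (a := a) (v := w)); rewrite -E.
by apply: pint; [exact: leqnn|exact: (fan_KX X_fan)|exact: (X_neq0 X_fan)].
Qed.

(** For [B ^+ s] the vertex [v] carries a loop, so [dominates_chain] applies to this power; the [d]
    initial steps and any surplus keep the vector interior. *)
Lemma dominates_loop_int d s i v m :
  dominates K B d (X i) (X v) -> dominates K B s (X v) (X v) ->
  (0 < s)%N -> (d + s * n.-1 <= m)%N -> interior K (B ^+ m *m X i).
Proof.
move=> iv vv s0 le.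
have [p pint] := primitive_late B_primitive.
have vi : interior K (B ^+ (s * n.-1) *m X v).
  rewrite exprM; apply: (dominates_chain X_fan (N := p)); first exact: pi_exp.
  - exact: (fan_KX X_fan).
  - by case: vv => eps e0 le'; exists eps; rewrite ?expr1.
  - rewrite mulmx_exprM; apply: pint; rewrite ?leq_pmull //.
      exact: (fan_KX X_fan).
    exact: (X_neq0 X_fan).
rewrite -(subnK le) (addnC d) mulmx_exprD.
apply: (primitive_int _ B_primitive).
case: iv => eps e0 le'; apply: (fan_int_ge X_fan e0 _ vi).
have := pi_exp (s * n.-1) KB le'.
by rewrite mulmxBr -scalemxAr -mulmx_exprD.
Qed.

Lemma long_exponent_labelling : ~ maps_into_interior K (B ^+ (n * n.-1).-1) ->
  exists f, wielandt_labelling n (edge B) f.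
Proof.
move=> nB.
have [i ni] : exists i, ~ interior K (B ^+ (n * n.-1).-1 *m X i).
  by apply/existsNP => Bi; apply/nB/maps_into_interiorP.
apply: (exists_wielandt_labelling (i := i)) => //.
- exact: card_ord.
- exact: edge_out.
- move=> d s v iv vv s0; rewrite leqNgt; apply/negP => sn; apply: ni.
  have [d' [s' [u [iu uu /andP[s'0 s's]]]]] := short_walk iv vv s0.
  rewrite card_ord => ds;
    apply: (dominates_loop_int (walk_dominates KB iu) (walk_dominates KB uu) s'0).
  have [k nE] : exists k, n = k.+4 by exists (n - 4)%N; lia.
  (* From [d' + s' <= n + 1] and [s' <= n - 1], the time [d' + s' * (n - 1)] is at most
     [n + 1 + (n - 1) * (n - 2)]. This is at most [n * (n - 1) - 1] exactly when [n >= 4]. *)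
  have : (s' * n.-1 + n.+1 - s' <= (n * n.-1).-1)%N; last by lia.
  have [j sE] : exists j, (j + s' = n.-1)%N by exists (n.-1 - s')%N; lia.
  rewrite nE /= in sE *; nia.
- exact: edge_no_rotation.
Qed.

End Labelling.
End FanDigraph.

(** * Wielandt matrices *)

Section WielandtMatrices.
Variables (R : realType) (n : nat) (K : set 'cV[R]_n) (X : 'I_n.+1 -> 'cV[R]_n).
Hypothesis X_fan : fan K X.
Let n_ge4 := fan_n_ge4 X_fan.
Let n_even := fan_n_even X_fan.
Implicit Types (y z : 'cV[R]_n) (A B C : 'M[R]_n).
Local Notation r := (@rel_coef R).
Local Notation x k := (X (inord k)).

Lemma sum_nat_ord (F : 'I_n.+1 -> 'cV[R]_n) :
  \sum_v F v = \sum_(0 <= k < n.+1) F (inord k).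
Proof. by rewrite big_mkord; apply: eq_bigr => v _; rewrite inord_val. Qed.

Lemma fan_rel_nat : \sum_(0 <= k < n.+1) r k *: x k = 0.
Proof.
have := fan_rel X_fan; rewrite sum_nat_ord => relE; rewrite -[RHS]relE.
apply: eq_big_nat => k /andP[_ kn].
by rewrite inordK.
Qed.

Lemma fan_map_ext A B : (forall k, (k <= n)%N -> A *m x k = B *m x k) -> A = B.
Proof.
move=> AB; apply/matrixP => i j.
have [c cE] := fan_span X_fan (delta_mx j 0).
have -> : A i j = (A *m delta_mx j 0 : 'cV_n) i 0 by rewrite -colE mxE.
have -> : B i j = (B *m delta_mx j 0 : 'cV_n) i 0 by rewrite -colE mxE.
rewrite cE !mulmx_sumr; congr fun_of_matrix; apply: eq_bigr => v _.
by rewrite -!scalemxAr -(inord_val v) AB // -ltnS.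
Qed.

(** The coordinates of [x k] are the indicator of [k] only up to a multiple of the relation; the
    hypothesis on [Y] annihilates the difference. *)
Lemma fan_map_exists (Y : nat -> 'cV[R]_n) : \sum_(0 <= k < n.+1) r k *: Y k = 0 ->
  exists B, forall k, (k <= n)%N -> B *m x k = Y k.
Proof.
move=> Yr; have [L LE] := fan_coord X_fan.
pose f y := \sum_v (L *m y) v 0 *: Y v.
exists (\matrix_(i, j) f (delta_mx j 0) i 0) => k kn.
have fE y : (\matrix_(i, j) f (delta_mx j 0) i 0) *m y = f y.
  rewrite mul_col_sum /f; apply/matrixP => i j; rewrite ord1 !summxE.
  under eq_bigr do rewrite !mxE summxE mulr_sumr.
  rewrite exchange_big /=; apply: eq_bigr => v _.
  rewrite [RHS]mxE [X in X * _]mxE mulr_suml; apply: eq_bigr => w _.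
  rewrite mxE -colE !mxE; ring.
rewrite fE /f.
have [l lE] : exists l, forall v : 'I_n.+1, (L *m x k) v 0 - (v == inord k)%:R = l * r v.
  apply: (fan_kernel X_fan); under eq_bigr do rewrite scalerBl.
  by rewrite sumrB -LE -X_delta subrr.
have cE v : (L *m x k) v 0 = (v == inord k)%:R + l * r v by rewrite -lE addrC subrK.
under eq_bigr do rewrite cE scalerDl -scalerA.
rewrite big_split /= -scaler_sumr.
have -> : \sum_(v < n.+1) r v *: Y v = 0 by rewrite -[RHS]Yr big_mkord.
rewrite scaler0 addr0 (bigD1 (inord k)) //= eqxx scale1r inordK // big1 ?addr0 //.
by move=> v /negPf ->; rewrite scale0r.
Qed.

Lemma cone_automorphism P (sg : 'I_n.+1 -> 'I_n.+1) (d : 'I_n.+1 -> R) :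
  (forall v, 0 < d v) -> (forall w, exists v, w = sg v) ->
  (forall v, P *m X v = d v *: X (sg v)) ->
  [/\ P \in unitmx, [set P *m y | y in K] = K &
      forall y, interior K y -> interior K (P *m y)].
Proof.
move=> d0 onto PE.
have XE w : exists2 a, 0 < a & exists v, X w = P *m (a *: X v).
  have [v ->] := onto w; exists (d v)^-1; first by rewrite invr_gt0.
  by exists v; rewrite -scalemxAr PE scalerA mulVf ?scale1r // gt_eqF.
have surj (c : 'I_n.+1 -> R) : exists2 z, P *m z = \sum_w c w *: X w &
    (forall w, 0 <= c w) -> K z.
  elim/big_ind: _ => [|u v [z <- Kz] [z' <- Kz']|w _].
  - by exists 0; rewrite ?mulmx0 // => _; exact: (fan_K0 X_fan).
  - exists (z + z'); rewrite ?mulmxDr // => c0.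
    by apply: (fan_KD X_fan); [exact: Kz|exact: Kz'].
  - have [a a0 [v ->]] := XE w; exists (c w *: (a *: X v)).
      by rewrite -scalemxAr.
    by move=> c0; rewrite scalerA; apply: (fan_KZ X_fan (mulr_ge0 _ (ltW a0))) => //;
      exact: (fan_KX X_fan).
have KP y : K y -> K (P *m y).
  have : pi_cone K P; last by apply.
  apply/(fan_pi X_fan) => v; rewrite PE.
  by apply: (fan_KZ X_fan (ltW (d0 v))); exact: (fan_KX X_fan).
have PK : [set P *m y | y in K] = K.
  apply/seteqP; split=> [_ [y Ky <-]|y /(fan_pos X_fan)[c c0 ->]]; first exact: KP.
  by have [z <- Kz] := surj c; exists z => //; apply: Kz.
split=> // [|y yi].
  have inv y : exists z, P *m z = y.
    by have [c ->] := fan_span X_fan y; have [z zE _] := surj c; exists z.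
  have [Q QE] := choice (fun j : 'I_n => inv (delta_mx j 0)).
  have : P *m (\matrix_(i, j) Q j i 0) = 1%:M.
    apply/matrixP => i j; have /matrixP/(_ i 0) := QE j.
    by rewrite !mxE eqxx andbT => <-; apply: eq_bigr => k _; rewrite !mxE.
  by case/mulmx1_unit.
have [z zE _] := surj (fun _ => 1).
have [eps e0 le] := nbhs_sub_ray z yi.
apply: (fan_int_ge X_fan e0 (z := P *m z)).
  by have := KP _ le; rewrite mulmxBr -scalemxAr.
rewrite zE; apply/(facet_int X_fan) => p q pq.
by rewrite facet_sum // /facet_coef; case: eqP => _; rewrite ?addr_gt0.
Qed.

(* [A_(alpha,beta)] is the case [c = 1]; the matrices with [a, b, c >= 0] make up
   its face in [pi K]. *)
Definition wielandt_matrix a b c A :=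
  [/\ A *m x 0 = a *: x 1 + c *: x 2, A *m x 1 = b *: x 2,
      forall k, (2 <= k < n)%N -> A *m x k = c *: x k.+1 &
      A *m x n = c *: x 0 + a *: x 1].

Lemma wielandt_matrix_unique a b c A B :
  wielandt_matrix a b c A -> wielandt_matrix a b c B -> A = B.
Proof.
move=> [A0 A1 A2 A3] [B0 B1 B2 B3]; apply: fan_map_ext => -[|[|k]] kn.
- by rewrite A0 B0.
- by rewrite A1 B1.
have [->|kn'] := eqVneq k.+2 n; first by rewrite A3 B3.
by rewrite A2 ?B2 //; lia.
Qed.

Lemma sum_nat_split (V : zmodType) (F : nat -> V) :
  \sum_(0 <= k < n.+1) F k = F 0%N + F 1%N + F n + \sum_(2 <= k < n) F k.
Proof.
rewrite big_ltn // big_ltn; last by lia.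
by rewrite big_nat_recr /=; [rewrite -!addrA; congr (_ + (_ + _)); rewrite addrC|lia].
Qed.

(** Compatibility with the relation: the terms in [x 1] cancel because [x 0] and [x n] have opposite
    coefficients, [n] being even, and what remains is [- c] times the relation itself. *)
Lemma wielandt_matrix_exists a b c : exists A, wielandt_matrix a b c A.
Proof.
pose Y k := if k == 0%N then a *: x 1 + c *: x 2 else if k == 1%N then b *: x 2
  else if k == n then c *: x 0 + a *: x 1 else c *: x k.+1.
have Yk k : (2 <= k < n)%N -> Y k = c *: x k.+1.
  by case: k => [|[|k]] // /andP[_ kn]; rewrite /Y /= ltn_eqF.
have Yn : Y n = c *: x 0 + a *: x 1.
  have [n0 n1] : (n == 0%N) = false /\ (n == 1%N) = false by lia.
  by rewrite /Y n0 n1 eqxx.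
have [|A AE] := @fan_map_exists Y.
  pose U := \sum_(3 <= k < n.+1) r k *: x k.
  have UE : U = x 2 - x 0.
    have := fan_rel_nat; do 3 (rewrite big_ltn; last by lia).
    rewrite -/U rel_coef2 scale0r scale1r add0r scaleN1r addrA => /eqP.
    by rewrite addrC addr_eq0 opprB => /eqP.
  rewrite sum_nat_split Yn (rel_coef_even R _ n_even) /=; last by lia.
  rewrite (eq_big_nat _ _ (F2 := fun k => - c *: (r k.+1 *: x k.+1))); last first.
    move=> k k2n; rewrite Yk // rel_coefS; last by case/andP: k2n.
    by rewrite !scalerA mulrNN mulrC.
  rewrite -scaler_sumr.
  have -> : \sum_(2 <= k < n) r k.+1 *: x k.+1 = U by rewrite /U [RHS]big_add1.
  rewrite UE.
  by rewrite /Y /=; apply/matrixP => i j; rewrite !mxE; ring.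
by exists A; split=> [||k kn|]; rewrite AE //; [lia|exact: Yk|lia].
Qed.

Lemma wielandt_matrixZ d a b c A :
  wielandt_matrix a b c A -> wielandt_matrix (d * a) (d * b) (d * c) (d *: A).
Proof.
move=> [A0 A1 A2 A3]; split=> [|||].
- by rewrite -scalemxAl A0 scalerDr !scalerA.
- by rewrite -scalemxAl A1 !scalerA.
- by move=> k kn; rewrite -scalemxAl A2 // !scalerA.
- by rewrite -scalemxAl A3 scalerDr !scalerA.
Qed.

(** Dividing by [c] normalises the long path. The vector at place 1 is absent from the relation and
    can be rescaled alone; the factor [a / c] on it turns [a / c] into [1] and [b / c] into
    [a / c * (b / c)]. *)
Lemma wielandt_conjugate B f a b c : 0 < a -> 0 < b -> 0 < c ->
    (forall v, exists2 k, (k <= n)%N & v = f k) ->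
    \sum_(0 <= k < n.+1) r k *: X (f k) = 0 ->
    B *m X (f 0%N) = a *: X (f 1%N) + c *: X (f 2%N) ->
    B *m X (f 1%N) = b *: X (f 2%N) ->
    (forall k, (2 <= k < n)%N -> B *m X (f k) = c *: X (f k.+1)) ->
    B *m X (f n) = c *: X (f 0%N) + a *: X (f 1%N) ->
  exists P c b A, [/\ 0 < c /\ 0 < b, wielandt_matrix 1 b 1 A,
    [/\ P \in unitmx, [set P *m y | y in K] = K &
      forall y, interior K y -> interior K (P *m y)] &
    B *m P = P *m (c *: A)].
Proof.
move=> a0 b0 c0 f_onto f_rel B0 B1 BS Bn.
have [A AW] := wielandt_matrix_exists 1 (a / c * (b / c)) 1.
pose d k := if k == 1%N then a / c else 1.
have [|P PE] := @fan_map_exists (fun k => d k *: X (f k)).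
  rewrite -[RHS]f_rel; apply: eq_big_nat => k _.
  by rewrite scalerA; congr (_ *: _); rewrite /d; case: eqP => [->|_] /=; ring.
exists P, c, (a / c * (b / c)), A; split=> //.
- by split=> //; rewrite mulr_gt0 ?divr_gt0.
- apply: (@cone_automorphism P (fun v => f v) (fun v => d v)).
  + by move=> v; rewrite /d; case: eqP => // _; exact: divr_gt0.
  + by move=> w; have [k kn ->] := f_onto w; exists (inord k); rewrite inordK.
  + by move=> v; rewrite -{1}(inord_val v) PE // -ltnS.
case: AW => A0 A1 A2 An; have c_neq0 : c != 0 by rewrite gt_eqF.
apply: fan_map_ext => k kn; rewrite -!mulmxA PE // -scalemxAr -!scalemxAl -scalemxAr.
have dS m : (m.+2 <= n)%N -> P *m x m.+2 = X (f m.+2).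
  by move=> mn; rewrite PE // scale1r.
have n2 : (2 <= n)%N by lia.
have n1 : (1 <= n)%N by lia.
case: k kn => [|[|k]] kn.
- rewrite /d /= scale1r A0 B0 mulmxDr -!scalemxAr PE ?dS //.
  by rewrite /d /= !scale1r scalerDr scalerA mulrC divfK.
- rewrite /d /= A1 B1 -!scalemxAr dS ?scalerA //.
  by congr (_ *: _); field.
rewrite scale1r; have [kE|kE] := eqVneq k.+2 n.
  rewrite kE An Bn mulmxDr !scale1r !PE //.
  by rewrite /d /= scale1r scalerDr scalerA mulrC divfK.
have kn' : (k.+2 < n)%N by rewrite ltn_neqAle kE.
by rewrite A2 // scale1r dS ?BS.
Qed.

(* The relation among the images forces the zero coefficient to sit at the
   second place of the labelling and the signs to alternate from there on. *)
Lemma labelling_wielandt_matrix B f : primitive K B ->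
    wielandt_labelling n (edge K X B) f ->
  exists P c b A, [/\ 0 < c /\ 0 < b, wielandt_matrix 1 b 1 A,
    [/\ P \in unitmx, [set P *m y | y in K] = K &
      forall y, interior K y -> interior K (P *m y)] &
    B *m P = P *m (c *: A)].
Proof.
move=> pB [f_inj fn f0 fk]; have KB : pi_cone K B by case: pB.
have [b [b0 bE be]] := edge_coef X_fan KB.
pose g k l := b (f k) (f l).
have g_ge0 k l : 0 <= g k l by apply: b0.
have g0 v w : ~ edge K X B v w -> b v w = 0.
  by move/negP; rewrite be -leNgt => b_le; apply/eqP; rewrite eq_le b_le b0.
have f_onto v : exists2 k, (k <= n)%N & v = f k.
  have inj : injective (fun k : 'I_n.+1 => f k).
    by move=> k l /f_inj eq; apply/val_inj/eq; rewrite -ltnS.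
  have [h _ hK] := injF_bij inj; exists (h v); last by rewrite hK.
  by rewrite -ltnS.
have sum_f (V : zmodType) (F : 'I_n.+1 -> V) : \sum_v F v = \sum_(0 <= k < n.+1) F (f k).
  rewrite big_mkord; apply: reindex; exists (fun v => inord (s2val (cid2 (f_onto v)))).
    move=> k _; case: cid2 => l /= ln /f_inj <-; rewrite ?inord_val //.
    by rewrite -ltnS.
  by move=> v _; case: cid2 => l /= ln vE; rewrite inordK.
pose rho k := r (f k).
(* The image of the relation under [B] is again a relation, hence [l] times the given one. *)
have [l lE] : exists l, forall v : 'I_n.+1, \sum_(w < n.+1) r w * b w v = l * r v.
  apply: (fan_kernel X_fan).
  have : B *m (\sum_(v < n.+1) r v *: X v) = 0 by rewrite (fan_rel X_fan) mulmx0.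
  rewrite mulmx_sumr => BX0; rewrite -[RHS]BX0.
  under eq_bigr do rewrite scaler_suml; rewrite exchange_big /=.
  apply: eq_bigr => v _; rewrite -scalemxAr bE scaler_sumr.
  by apply: eq_bigr => w _; rewrite scalerA.
have gE k : \sum_(0 <= j < n.+1) rho j * g j k = l * rho k by rewrite -lE sum_f.
have gk j k : (0 < j < n)%N -> (k <= n)%N -> k <> j.+1 -> g j k = 0.
  move=> jn kn kj; apply: g0 => /(fk _ _ jn)/f_inj; lia.
have gn k : (2 <= k <= n)%N -> g n k = 0.
  by move=> kn; apply: g0 => /fn[]/f_inj; lia.
have g0k k : (k <= n)%N -> k <> 1%N -> k <> 2%N -> g 0%N k = 0.
  by move=> kn k1 k2; apply: g0 => /f0[]/f_inj; lia.
have mid k : (k <= 2)%N -> \sum_(2 <= j < n) rho j * g j k = 0.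
  move=> k2; rewrite big_nat_cond big1 // => j; rewrite andbT => /andP[j2 jn].
  by rewrite gk ?mulr0 //; lia.
have E0 : rho n * g n 0%N = l * rho 0%N.
  by rewrite -gE sum_nat_split mid // g0k // (gk 1%N) ?mulr0 ?add0r ?addr0 //; lia.
have E1 : rho 0%N * g 0%N 1%N + rho n * g n 1%N = l * rho 1%N.
  by rewrite -gE sum_nat_split mid // (gk 1%N) ?mulr0 ?addr0 //; lia.
have E2 : rho 0%N * g 0%N 2%N + rho 1%N * g 1%N 2%N = l * rho 2%N.
  by rewrite -gE sum_nat_split mid // (gn 2%N) ?mulr0 ?addr0 //; lia.
have Ek k : (2 <= k < n)%N -> rho k * g k k.+1 = l * rho k.+1.
  move=> kn; rewrite -gE sum_nat_split (g0k k.+1) ?(gk 1%N) ?(gn k.+1); try lia.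
  rewrite !mulr0 !add0r (bigD1_seq k) ?mem_index_iota ?iota_uniq //= big_nat_cond big1
    ?addr0 //.
  by move=> j /andP[jn jk]; rewrite gk ?mulr0 //; lia.
have gn0 : 0 < g n 0%N by rewrite /g -be; apply/fn; left.
have gn1 : 0 < g n 1%N by rewrite /g -be; apply/fn; right.
have gkS k : (0 < k < n)%N -> 0 < g k k.+1.
  move=> kn; have [w kw] := edge_out X_fan pB (f k).
  by rewrite /g -be -(fk _ _ kn kw).
have rho0 k : (k <= n)%N -> f k <> inord 1 -> rho k = 1 \/ rho k = -1.
  move=> kn fk1; apply: rel_coef_cases; apply/eqP; rewrite -eq_o; last by lia.
  exact/eqP.
have f_zero j k : (j <= n)%N -> (k <= n)%N -> j <> k -> rho j = 0 -> rho k = 0 -> False.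
  move=> jn kn jk j0 k0.
  have z i : (i <= n)%N -> rho i = 0 -> f i = inord 1.
    move=> i_n i0; apply: contrapT => /(rho0 i i_n)[]; rewrite i0; lra.
  by apply/jk/f_inj; rewrite ?z.
(* With [l = 0] the coefficients at places 2 and [n] would both vanish, but only one extreme vector
   is missing from the relation. *)
have l_neq0 : l <> 0.
  move=> l0; have rn : rho n = 0 by move: E0; rewrite l0 mul0r; nra.
  have r2 : rho 2%N = 0 by have := Ek 2%N ltac:(lia); have := gkS 2%N ltac:(lia);
    rewrite l0 mul0r; nra.
  by apply: (f_zero 2%N n _ _ _ r2 rn); lia.
(* A zero at any other place creates a second one: at [n] from 0, at 0 from [n], and at [k + 1] from
   any [k] with [2 <= k < n]. *)
have f1 : f 1%N = inord 1.
  have [k kn fk1] := f_onto (inord 1).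
  have rk : rho k = 0 by rewrite /rho -fk1 inordK //; lia.
  have [k1|k1] := eqVneq k 1%N; first by rewrite fk1 k1.
  exfalso; have [k0|k0] := eqVneq k 0%N.
    have rn : rho n = 0 by move: E0 rk; rewrite k0 => E0 rk; rewrite rk mulr0 in E0; nra.
    by apply: (f_zero k n kn _ _ rk rn); lia.
  have [kn'|kn'] := eqVneq k n.
    have r0 : rho 0%N = 0.
      have /eqP := E0; rewrite -kn' rk mul0r eq_sym mulf_eq0 => /orP[/eqP//|/eqP//].
    by apply: (f_zero k 0%N kn _ _ rk r0); lia.
  have rk1 : rho k.+1 = 0.
    have /eqP := Ek k ltac:(lia); rewrite rk mul0r eq_sym mulf_eq0 => /orP[/eqP//|/eqP//].
  by apply: (f_zero k k.+1 kn _ _ rk rk1); lia.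
have rho1 : rho 1%N = 0 by rewrite /rho f1 inordK //; lia.
have pm k : (k <= n)%N -> k <> 1%N -> rho k = 1 \/ rho k = -1.
  by move=> kn k1; apply: rho0 => //; rewrite -f1 => /f_inj; lia.
have pm0 := pm 0%N isT ltac:(lia).
have pmn := pm n (leqnn n) ltac:(lia).
have pm2 := pm 2%N ltac:(lia) ltac:(lia).
have g01_ge0 := g_ge0 0%N 1%N.
have g02_ge0 := g_ge0 0%N 2%N.
(* Nonnegative weights now fix the signs. The equations at places 1 and 2 also show that both
   optional edges out of [f 0] occur, with the same weights as the edges out of [f n]. *)
have rhon : rho n = - rho 0%N.
  by move: E1; rewrite rho1; case: pm0 pmn => -> [] ->; lra.
have g01 : g 0%N 1%N = g n 1%N.
  by move: E1; rewrite rho1 rhon; case: pm0 => ->; lra.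
have lE' : l = - g n 0%N.
  by move: E0; rewrite rhon; case: pm0 => ->; lra.
have rho2 : rho 2%N = - rho 0%N.
  by move: E2; rewrite rho1 lE'; case: pm0 pm2 => -> [] ->; lra.
have g02 : g 0%N 2%N = g n 0%N.
  by move: E2; rewrite rho1 rho2 lE'; case: pm0 => ->; lra.
have rhoS k : (2 <= k < n)%N -> rho k.+1 = - rho k /\ g k k.+1 = g n 0%N.
  move=> kn; have := Ek k kn; have := gkS k ltac:(lia); rewrite lE'.
  have := pm k ltac:(lia) ltac:(lia); have := pm k.+1 ltac:(lia) ltac:(lia).
  by move=> [] -> [] -> ? ?; lra.
have rhoE k : (k <= n)%N -> rho k = rho 0%N * r k.
  elim: k => [|[|[|k]] IHk] kn; first by rewrite mulr1.
  - by rewrite rho1 mulr0.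
  - by rewrite rho2 rel_coef2 mulrN1.
  have [-> _] := rhoS k.+2 ltac:(lia); rewrite IHk; last by lia.
  by rewrite [in RHS]rel_coefS // mulrN.
have BX k : B *m X (f k) = \sum_(0 <= j < n.+1) g k j *: X (f j).
  by rewrite bE sum_f.
have Bn : B *m X (f n) = g n 0%N *: X (f 0%N) + g n 1%N *: X (f 1%N).
  rewrite BX sum_nat_split (gn n) ?scale0r ?addr0; last by lia.
  rewrite big_nat_cond big1 ?addr0 // => j; rewrite andbT => /andP[j2 jn].
  by rewrite gn ?scale0r //; lia.
have B0 : B *m X (f 0%N) = g n 1%N *: X (f 1%N) + g n 0%N *: X (f 2%N).
  rewrite BX sum_nat_split g01 (g0k 0%N) // (g0k n) ?scale0r ?add0r ?addr0; try lia.
  rewrite big_ltn ?g02; last by lia.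
  congr (_ + _); rewrite -[RHS]addr0; congr (_ + _).
  rewrite big_nat_cond big1 // => j; rewrite andbT => /andP[j2 jn].
  by rewrite g0k ?scale0r //; lia.
have BS k : (0 < k < n)%N -> B *m X (f k) = g k k.+1 *: X (f k.+1).
  move=> kn; rewrite BX (bigD1_seq k.+1) ?mem_index_iota ?iota_uniq //=; last by lia.
  rewrite big_nat_cond big1 ?addr0 // => j /andP[/andP[_ jn] /eqP jk].
  by rewrite gk ?scale0r //; lia.
have rel_f : \sum_(0 <= k < n.+1) r k *: X (f k) = 0.
  apply: (@scalerI _ _ (rho 0%N)); first by case: pm0 => ->; rewrite ?oppr_eq0 oner_eq0.
  rewrite scaler0 scaler_sumr -[RHS](fan_rel X_fan) sum_f;
    apply: eq_big_nat => k /andP[_ kn].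
  by rewrite scalerA -rhoE // -ltnS.
apply: (@wielandt_conjugate B f (g n 1%N) (g 1%N 2%N) (g n 0%N)) => //.
- by apply: gkS; lia.
- by apply: BS; lia.
- by move=> k kn; rewrite BS ?(rhoS k kn).2 //; lia.
Qed.

End WielandtMatrices.

(** * The exponent of a Wielandt matrix and of its cone *)

Section WielandtExponent.
Variables (R : realType) (n : nat) (K : set 'cV[R]_n) (X : 'I_n.+1 -> 'cV[R]_n).
Hypothesis X_fan : fan K X.
Let n_ge4 := fan_n_ge4 X_fan.
Implicit Types (y z : 'cV[R]_n) (A B C : 'M[R]_n).
Local Notation x k := (X (inord k)).

Lemma fan_Kx k : K (x k). Proof. exact: (fan_KX X_fan). Qed.

Lemma wielandt_matrix_pi a b c A : 0 <= a -> 0 <= b -> 0 <= c ->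
  wielandt_matrix X a b c A -> pi_cone K A.
Proof.
move=> a0 b0 c0 [A0 A1 A2 A3]; apply/(fan_pi X_fan) => v.
rewrite -(inord_val v); case: (nat_of_ord v) (ltn_ord v) => [|[|k]] kn.
- by rewrite A0; apply: (fan_KD X_fan); apply: (fan_KZ X_fan) => //; exact: fan_Kx.
- by rewrite A1; apply: (fan_KZ X_fan) => //; exact: fan_Kx.
have [->|kE] := eqVneq k.+2 n.
  by rewrite A3; apply: (fan_KD X_fan); apply: (fan_KZ X_fan) => //; exact: fan_Kx.
by rewrite A2; [apply: (fan_KZ X_fan) => //; exact: fan_Kx|lia].
Qed.

Lemma wielandt_matrix_orbit a b A k : wielandt_matrix X a b 1 A ->
  (k <= n - 2)%N -> A ^+ k *m x 2 = x k.+2.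
Proof.
move=> [_ _ A2 _]; elim: k => [|k IHk] kn; first by rewrite mulmx_expr0.
by rewrite mulmx_exprS IHk ?A2 ?scale1r //; lia.
Qed.

Lemma wielandt_matrix_recurrence a b A : wielandt_matrix X a b 1 A ->
  A ^+ n.+1 *m x 2 = (1 + a * b) *: (A *m x 2) + (a * b) *: x 2.
Proof.
move=> AW; have [A0 A1 _ An] := AW; have -> : n.+1 = (n - 2).+3 by lia.
rewrite !mulmx_exprS (wielandt_matrix_orbit AW) // (_ : (n - 2).+2 = n); last by lia.
rewrite An scale1r mulmxDr -scalemxAr A1 A0 !mulmxDr -!scalemxAr A1.
by move: (A *m x 2) => w; apply/matrixP => i j; rewrite !mxE; ring.
Qed.

Section Exponent.
Variables (a b : R) (A : 'M[R]_n).
Hypotheses (a_gt0 : 0 < a) (b_gt0 : 0 < b) (A_wielandt : wielandt_matrix X a b 1 A).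

Let KA : pi_cone K A.
Proof. by apply: wielandt_matrix_pi A_wielandt; rewrite ?ler01 ?ltW. Qed.

Local Notation dom := (dominates K A).

Let domD k l u v w : dom k u v -> dom l v w -> dom (k + l) u w.
Proof. exact: (dominates_trans X_fan KA). Qed.

Let dom_id v : dom 0 (X v) (X v).
Proof.
exists 1; rewrite ?ltr01 // mulmx_expr0 scale1r subrr; exact: (fan_K0 X_fan).
Qed.

Let domZ d k l : 0 < d -> A *m x k - d *: x l = 0 -> dom 1 (x k) (x l).
Proof. by move=> d0 E; exists d; rewrite // expr1 E; apply: (fan_K0 X_fan). Qed.

Let dom02 : dom 1 (x 0) (x 2).
Proof.
case: A_wielandt => A0 _ _ _; exists 1; rewrite ?ltr01 // expr1 A0 addrK.
by apply: (fan_KZ X_fan (ltW a_gt0)); exact: fan_Kx.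
Qed.

Let domn0 : dom 1 (x n) (x 0).
Proof.
case: A_wielandt => _ _ _ An; exists 1; rewrite ?ltr01 // expr1 An addrC addKr.
by apply: (fan_KZ X_fan (ltW a_gt0)); exact: fan_Kx.
Qed.

Let domn1 : dom 1 (x n) (x 1).
Proof.
case: A_wielandt => _ _ _ An; exists a; rewrite ?ltr01 // expr1 An addrK scale1r.
exact: fan_Kx.
Qed.

Let domS k : (k < n)%N -> dom 1 (x k) (x k.+1).
Proof.
case: A_wielandt => A0 A1 A2 _; case: k => [|[|k]] kn.
- exists a => //; rewrite expr1 A0 addrC addKr scale1r; exact: fan_Kx.
- by apply: (domZ b_gt0); rewrite A1 subrr.
- by apply: (domZ ltr01); rewrite A2 ?subrr //; lia.
Qed.

Let dom_path k m : (k + m <= n)%N -> dom m (x k) (x (k + m)).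
Proof.
elim: m => [|m IHm] km; first by rewrite addn0; apply: dom_id.
rewrite -addn1; apply: (domD (v := x (k + m))); first by apply: IHm; lia.
by rewrite addn1 addnS; apply: domS; lia.
Qed.

Let dom_path' k l : (k <= l <= n)%N -> dom (l - k) (x k) (x l).
Proof.
move=> /andP[kl ln]; have := @dom_path k (l - k).
by rewrite subnKC //; apply.
Qed.

Let dom_loop k : (k <= n)%N -> dom n (x k) (x k).
Proof.
case: k => [|k] kn.
  have := domD dom02 (domD (@dom_path' 2 n ltac:(lia)) domn0).
  by rewrite (_ : 1 + _ = n)%N; last by lia.
have := domD (@dom_path' k.+1 n ltac:(lia)) (domD domn1 (@dom_path' 1 k.+1 ltac:(lia))).
by rewrite (_ : n - _ + _ = n)%N; last by lia.
Qed.

Let dom_loopS k : (k <= n)%N -> dom n.+1 (x k) (x k).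
Proof.
move=> kn; have := domD (@dom_path' k n ltac:(lia)) (domD domn0 (@dom_path' 0 k
  ltac:(lia))).
by rewrite (_ : n - _ + _ = n.+1)%N; last by lia.
Qed.

Let dom_dist k l : (k <= n)%N -> (l <= n)%N -> exists2 m, (m <= n)%N & dom m (x k) (x l).
Proof.
move=> kn ln; have [kl|lk] := leqP k l.
  by exists (l - k)%N; [lia|apply: dom_path'; lia].
exists ((n - k) + (1 + (l - 0)))%N; first lia.
by apply: (domD (dom_path' _) (domD domn0 (dom_path' _))); lia.
Qed.

Lemma wielandt_matrix_primitive : primitive K A.
Proof.
split=> //; exists (n * n + n)%N; first by lia.
apply/(maps_into_interiorP X_fan) => v; apply/(facet_int X_fan) => p q pq.
have vn : (v <= n)%N by rewrite -ltnS.
have pn : (p <= n)%N by rewrite -ltnS.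
have [m mn vp] := dom_dist vn pn.
(* The [L >= n * n] steps left after reaching [p] are spent on loops of the coprime lengths [n] and
   [n + 1]: the remainder [s] counts the long loops, and [t >= 0] because [s < n <= L %/ n]. *)
pose L := (n * n + n - m)%N; pose s := (L %% n)%N; pose t := (L %/ n - s)%N.
have Lge : (n * n <= L)%N by rewrite /L; lia.
have sn : (s < n)%N by rewrite ltn_mod; lia.
have dn : (n <= L %/ n)%N by rewrite leq_divRL //; lia.
have LE : L = (n * t + n.+1 * s)%N.
  rewrite /t mulnBr {1}(divn_eq L n) -/s; have : (s <= L %/ n)%N by lia.
  by move=> /(leq_mul (leqnn n)); rewrite mulSn; lia.
have [eps e0 /(K_facet X_fan)/(_ p q pq)] : dom (n * n + n) (x v) (x p).
  have -> : (n * n + n = m + (n * t + n.+1 * s))%N by rewrite -LE /L; lia.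
  apply: (domD vp); apply: domD; apply: (dominates_iter X_fan) => //.
    exact: dom_loop.
  exact: dom_loopS.
rewrite facetB facetZ !inord_val facet_X_eq1 // mulr1 subr_ge0.
exact: lt_le_trans.
Qed.

Lemma wielandt_matrix_int : maps_into_interior K (A ^+ (n * n.-1)).
Proof.
apply/(maps_into_interiorP X_fan) => v.
apply: (dominates_loop_int X_fan wielandt_matrix_primitive (dom_id v) (s := n)) => //.
  by rewrite -(inord_val v); apply: dom_loop; rewrite -ltnS.
by lia.
Qed.

(* The first facet functional reads off the coefficient of [x 1]; it takes
   nonzero values on [A^k x 2] only for [k] in the windows
   [j * n - 1 .. j * n + j - 1]. *)
Lemma wielandt_matrix_gap j k : (j * n.+1 <= k <= j.+1 * n - 2)%N ->
  facet X_fan (inord 1) (inord 1) (A ^+ k *m x 2) = 0.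
Proof.
have pq : facet_pair R (inord 1 : 'I_n.+1) (inord 1) by rewrite /facet_pair eqxx.
elim: j k => [|j IHj] k jk.
  rewrite (wielandt_matrix_orbit A_wielandt); last by lia.
  by rewrite facet_X // /facet_coef eqxx -val_eqE /= !inordK //; lia.
have kE : k = (k - n.+1 + n.+1)%N by lia.
rewrite kE mulmx_exprD (wielandt_matrix_recurrence A_wielandt) mulmxDr -!scalemxAr.
have E m : A ^+ m *m (A *m x 2) = A ^+ m.+1 *m x 2.
  by rewrite -[m.+1]addn1 mulmx_exprD expr1.
rewrite E.
by rewrite facetD !facetZ !IHj ?mulr0 ?addr0 //; lia.
Qed.

(** Interior vectors stay interior, so it suffices to refute the power [n * (n - 1) - 1] at [x 1].
    One step leads to [b *: x 2], and the remaining [n * (n - 1) - 2] steps are the single point of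
    the gap [j = n - 2]. *)
Lemma wielandt_matrix_not_int p : (0 < p)%N ->
  maps_into_interior K (A ^+ p) -> (n * n.-1 <= p)%N.
Proof.
move=> p0 Ap; rewrite leqNgt; apply/negP => lt.
have pq : facet_pair R (inord 1 : 'I_n.+1) (inord 1) by rewrite /facet_pair eqxx.
have : interior K (A ^+ (n * n.-1).-1 *m x 1).
  rewrite (_ : (n * n.-1).-1 = (n * n.-1).-1 - p + p)%N; last by lia.
  rewrite mulmx_exprD; apply: (primitive_int X_fan _ wielandt_matrix_primitive).
  by apply: Ap; [exact: fan_Kx|exact: (X_neq0 X_fan)].
have [k nE] : exists k, n = k.+4 by exists (n - 4)%N; lia.
rewrite (_ : (n * n.-1).-1 = (n * n.-1 - 2).+1)%N; last by rewrite nE; nia.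
rewrite -[(_ - 2).+1]addn1 mulmx_exprD expr1; case: (A_wielandt) => _ -> _ _.
rewrite -scalemxAr => /(facet_int X_fan)/(_ _ _ pq).
rewrite facetZ (wielandt_matrix_gap (j := n - 2)) ?mulr0 ?ltxx //.
by rewrite nE /=; nia.
Qed.

Lemma wielandt_matrix_exponent : exponent K A (n * n.-1).
Proof.
split; [exact: wielandt_matrix_primitive| |exact: wielandt_matrix_int|exact:
  wielandt_matrix_not_int].
by rewrite muln_gt0; lia.
Qed.

End Exponent.

(** The value of [h] is carried over from [wielandt_matrix_int] by the conjugation, since [P] maps
    [K] onto [K] and preserves its interior. *)
Lemma long_exponent_wielandt B h : exponent K B h -> (n * n.-1 <= h)%N ->
  h = (n * n.-1)%N /\ exists P c b A, [/\ 0 < c /\ 0 < b, wielandt_matrix X 1 b 1 A,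
    P \in unitmx, [set P *m y | y in K] = K & B *m P = P *m (c *: A)].
Proof.
move=> [pB h0 Bh hmin] le.
have nB : ~ maps_into_interior K (B ^+ (n * n.-1).-1).
  by move=> /hmin; have : (0 < (n * n.-1).-1)%N; [nia|move=> -> /(_ isT); nia].
have [f fW] := long_exponent_labelling X_fan pB nB.
have [P [c [b [A [[c0 b0] AW [Pu PK Pint] BP]]]]] := labelling_wielandt_matrix X_fan pB fW.
split; last by exists P, c, b, A; exact: And5 (conj c0 b0) AW Pu PK BP.
apply/eqP; rewrite eqn_leq le andbT; apply: hmin; first by rewrite muln_gt0; lia.
have Bk k y : B ^+ k *m (P *m y) = c ^+ k *: (P *m (A ^+ k *m y)).
  elim: k => [|k IHk]; first by rewrite !mulmx_expr0 expr0 scale1r.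
  rewrite !mulmx_exprS IHk -scalemxAr [B *m (P *m _)]mulmxA BP -scalemxAr -scalemxAl.
  by rewrite scalerA -exprSr -mulmxA.
move=> y Ky y0; move: (Ky); rewrite -{1}PK => -[z Kz zE].
rewrite -zE Bk; apply: (fan_intZ X_fan); first by rewrite exprn_gt0.
have Aint := wielandt_matrix_int ltr01 b0 AW.
apply/Pint/Aint; first exact: Kz.
by apply: contraNneq y0 => z0; rewrite -zE z0 mulmx0.
Qed.

Lemma wielandt_cone_exponent : cone_exponent K (n * n.-1).
Proof.
have [A AW] := wielandt_matrix_exists X_fan 1 1 1.
split; first by exists A; apply: (wielandt_matrix_exponent ltr01 ltr01 AW).
move=> B h Bh; case: (leqP h (n * n.-1)) => // lt.
by have [hE _] := long_exponent_wielandt Bh (ltnW lt); rewrite hE ltnn in lt.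
Qed.

Lemma wielandt_exp_maximal a b A : 0 < a -> 0 < b -> wielandt_matrix X a b 1 A ->
  exp_maximal_mx K A.
Proof.
move=> a0 b0 AW; exists (n * n.-1)%N; last exact: wielandt_cone_exponent.
exact: (wielandt_matrix_exponent a0 b0 AW).
Qed.

Lemma exp_maximal_wielandt B : exp_maximal_mx K B ->
  exists P c b A, [/\ 0 < c /\ 0 < b, wielandt_matrix X 1 b 1 A,
    P \in unitmx, [set P *m y | y in K] = K & B *m P = P *m (c *: A)].
Proof.
move=> [g Bg [_ gmax]]; have [[A Ae] _] := wielandt_cone_exponent.
by have [_] := long_exponent_wielandt Bg (gmax _ _ Ae).
Qed.

End WielandtExponent.

(** * The face generated by a Wielandt matrix *)

Section WielandtFace.
Variables (R : realType) (n : nat) (K : set 'cV[R]_n) (X : 'I_n.+1 -> 'cV[R]_n).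
Hypothesis X_fan : fan K X.
Let n_ge4 := fan_n_ge4 X_fan.
Let n_even := fan_n_even X_fan.
Implicit Types (y z : 'cV[R]_n) (A B M N : 'M[R]_n).
Local Notation x k := (X (inord k)).
Local Notation r := (@rel_coef R).

(** Each side of the relation has at least two members (0 and 3, 2 and 4), so every other index [v]
    has an opposite [u] distinct from [s]. The facet functional [c v + c u] vanishes on the upper
    bound, hence on [y]. *)
Lemma dominated_support a b s y : (s <= n)%N -> s <> 1%N -> K y ->
  K (a *: x 1 + b *: x s - y) ->
  exists a' b', [/\ 0 <= a' <= a, 0 <= b' & y = a' *: x 1 + b' *: x s].
Proof.
move=> sn s1 /(fan_pos X_fan)[c c0 yE] le.
have os1 : (inord s == inord 1 :> 'I_n.+1) = false.
  by rewrite -val_eqE /= !inordK //; lia.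
pose m (v : 'I_n.+1) : R := a * (v == inord 1)%:R + b * (v == inord s)%:R.
have mE : a *: x 1 + b *: x s = \sum_v m v *: X v.
  under eq_bigr do rewrite scalerDl -!scalerA.
  by rewrite big_split /= -!scaler_sumr -!X_delta.
have dom p q : facet_pair R p q -> facet_coef p q c <= facet_coef p q m.
  move=> pq; have /(K_facet X_fan)/(_ p q pq) := le.
  by rewrite facetB yE mE !facet_sum // subr_ge0.
have c1 : c (inord 1) <= a.
  have := dom (inord 1) (inord 1); rewrite /facet_pair /facet_coef /m !eqxx /=.
  by rewrite eq_sym os1 mulr0 addr0 mulr1; apply.
have opp (v : 'I_n.+1) : v != inord 1 -> v != inord s -> exists u, [/\ u != inord 1, u
  != inord s &
    facet_pair R v u \/ facet_pair R u v].
  move=> v1 vs; have : v <> 1%N :> nat by apply/eqP; rewrite -eq_o //; lia.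
  have o_neq k : (k <= n)%N -> k <> 1%N -> k <> s ->
      inord k != inord 1 :> 'I_n.+1 /\ inord k != inord s :> 'I_n.+1.
    by move=> kn k1 ks; rewrite -!val_eqE /= !inordK //; lia.
  case/(rel_coef_cases R) => rv.
    have [k [kn k1 ks rk]] : exists k, [/\ (k <= n)%N, k <> 1%N, k <> s & r k = -1].
      have [s2|s2] := eqVneq s 2%N; last by exists 2%N; rewrite rel_coef2; split=> //; lia.
      by exists 4%N; rewrite rel_coef_even //; split=> //; lia.
    have [k1' ks'] := o_neq k kn k1 ks; exists (inord k); split=> //; left.
    by rewrite /facet_pair rv inordK // rk !eqxx orbT.
  have [k [kn k1 ks rk]] : exists k, [/\ (k <= n)%N, k <> 1%N, k <> s & r k = 1].
    have [s0|s0] := eqVneq s 0%N; last by exists 0%N; split=> //; lia.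
    exists 3%N; split=> //; [lia|lia|]; by rewrite rel_coefS // rel_coef2 opprK.
  have [k1' ks'] := o_neq k kn k1 ks; exists (inord k); split=> //; right.
  by rewrite /facet_pair rv inordK // rk !eqxx orbT.
have c_zero v : v != inord 1 -> v != inord s -> c v = 0.
  move=> v1 vs; have [u [u1 us pq]] := opp v v1 vs.
  have mz w : w != inord 1 -> w != inord s -> m w = 0.
    by move=> /negPf w1 /negPf ws; rewrite /m w1 ws !mulr0 addr0.
  have sum0 : c v + c u <= 0.
    case: pq => /dom; rewrite /facet_coef ?(negPf v1) ?(negPf u1) !mz // addr0 //.
    by rewrite addrC.
  by have := c0 v; have := c0 u; lra.
exists (c (inord 1)), (c (inord s)); split; rewrite ?c0 //.
rewrite yE (bigD1 (inord 1)) //= (bigD1 (inord s)) ?os1 //= big1 ?addr0 //.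
by move=> v /andP[v1 vs]; rewrite c_zero ?scale0r.
Qed.

(** [dominated_support] confines each [N *m x k] to the extreme vectors that occur in [M *m x k];
    the relation, mapped by [N], then makes the separate coefficients agree. *)
Lemma wielandt_matrix_lower a b c M N : wielandt_matrix X a b c M ->
    pi_cone K N -> pi_cone K (M - N) ->
  exists a' b' c', [/\ 0 <= a', 0 <= b', 0 <= c' & wielandt_matrix X a' b' c' N].
Proof.
move=> [M0 M1 M2 M3] KN KMN.
have KNx k : K (N *m x k) by apply/KN/(fan_KX X_fan).
have le k : K (M *m x k - N *m x k).
  by rewrite -mulmxBl; apply/KMN/(fan_KX X_fan).
have [a0 [c0 [/andP[a0_ge0 _] c0_ge0 N0]]] :
    exists a' c', [/\ 0 <= a' <= a, 0 <= c' & N *m x 0 = a' *: x 1 + c' *: x 2].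
  by apply: (@dominated_support a c) => //; [lia|rewrite -M0].
have [an [cn [/andP[an_ge0 _] cn_ge0 Nn]]] :
    exists a' c', [/\ 0 <= a' <= a, 0 <= c' & N *m x n = a' *: x 1 + c' *: x 0].
  by apply: (@dominated_support a c) => //; rewrite [X in X - _]addrC -M3.
have ext k b' : (2 <= k <= n)%N -> forall l, M *m x l = b' *: x k ->
    exists2 c', 0 <= c' & N *m x l = c' *: x k.
  move=> k2n l Ml; have [||||a' [c' [a'0 c'0 NE]]] := @dominated_support 0 b' k (N *m x l).
  - by lia.
  - by lia.
  - exact: KNx.
  - by rewrite scale0r add0r -Ml.
  by exists c' => //; rewrite NE (_ : a' = 0) ?scale0r ?add0r //; apply/le_anti;
    rewrite andbC.
have [b' b'0 N1] := ext 2%N b ltac:(lia) 1%N M1.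
have extk k : exists c', (2 <= k < n)%N -> 0 <= c' /\ N *m x k = c' *: x k.+1.
  have [kn|kn] := boolP (2 <= k < n)%N; last by exists 0.
  by have [c' c'0 NE] := ext k.+1 c ltac:(lia) k (M2 k kn); exists c'.
have [g gE] := choice extk.
(* The coefficients of the image of the relation under [N], with [g] shifted because [x k] goes to a
   multiple of [x k.+1]. The scalar [b'] is absent, as [x 1] has coefficient 0, and so remains a
   free parameter. *)
pose e k := if k == 0%N then - cn else if k == 1%N then a0 - an
  else if k == 2%N then c0 else r k.-1 * g k.-1.
have eE : \sum_(0 <= k < n.+1) e k *: x k = 0.
  have : N *m (\sum_(0 <= k < n.+1) r k *: x k) = 0 by rewrite (fan_rel_nat X_fan) mulmx0.
  rewrite mulmx_sumr => relN; rewrite -[RHS]relN (sum_nat_split X_fan (fun k => N *m _)).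
  do 3 (rewrite big_ltn; last by lia).
  rewrite big_add1 /=.
  have <- : \sum_(2 <= k < n) N *m (r k *: x k) = \sum_(2 <= k < n) e k.+1 *: x k.+1.
    apply: eq_big_nat => k k2n; have [_ NE] := gE k k2n.
    by rewrite -scalemxAr NE scalerA /e; case: k k2n {NE} => [|[|k]].
  move: (\sum_(_ <= _ < _) _) => S.
  rewrite -!scalemxAr N0 Nn N1 (rel_coef_even R _ n_even); last by lia.
  rewrite /e /=.
  by apply/matrixP => i j; rewrite !mxE; ring.
have [l lE] : exists l, forall v : 'I_n.+1, e v = l * r v.
  apply: (fan_kernel X_fan); rewrite sum_nat_ord -[RHS]eE;
    apply: eq_big_nat => k /andP[_ kn].
  by rewrite inordK.
have {}lE k : (k <= n)%N -> e k = l * r k.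
  by move=> kn; have := lE (inord k); rewrite inordK.
have l_cn : l = - cn by have := lE 0%N isT; rewrite /e /= mulr1.
have a0an : a0 = an.
  by have /eqP := lE 1%N ltac:(lia); rewrite /e /= mulr0 subr_eq0 => /eqP.
have c0cn : c0 = cn.
  by have := lE 2%N ltac:(lia); rewrite /e rel_coef2 l_cn mulrN1 opprK.
have gcn k : (2 <= k < n)%N -> g k = cn.
  case: k => [|[|k]] // /andP[_ kn].
  have E3 : r k.+2 * g k.+2 = l * r k.+3 := lE k.+3 kn.
  have r0 : r k.+2 != 0 by apply: rel_coef_neq0.
  by apply: (mulfI r0); rewrite E3 l_cn rel_coefS // mulrNN mulrC.
exists a0, b', c0; split=> //; split=> // [k kn|].
  by have [_ ->] := gE k kn; rewrite gcn // c0cn.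
by rewrite Nn c0cn a0an addrC.
Qed.

Lemma wielandt_matrixD a b c a' b' c' M N :
  wielandt_matrix X a b c M -> wielandt_matrix X a' b' c' N ->
  wielandt_matrix X (a + a') (b + b') (c + c') (M + N).
Proof.
move=> [M0 M1 M2 M3] [N0 N1 N2 N3]; split=> [|||].
- by rewrite mulmxDl M0 N0 !scalerDl addrACA.
- by rewrite mulmxDl M1 N1 scalerDl.
- by move=> k kn; rewrite mulmxDl M2 // N2 // scalerDl.
- by rewrite mulmxDl M3 N3 !scalerDl addrACA.
Qed.

Definition wielandt_gen_spec (E : 'I_3 -> 'M[R]_n) := forall i : 'I_3,
  wielandt_matrix X (i == 0%N :> nat)%:R (i == 1%N :> nat)%:R (i == 2%N :> nat)%:R (E i).

Lemma wielandt_gen_exists : exists E, wielandt_gen_spec E.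
Proof.
have [E EP] := choice (fun i : 'I_3 => wielandt_matrix_exists X_fan
  (i == 0%N :> nat)%:R (i == 1%N :> nat)%:R (i == 2%N :> nat)%:R).
by exists E.
Qed.

Definition wielandt_dual (i : 'I_3) M : R :=
  if i == 0%N :> nat then facet X_fan (inord 1) (inord 1) (M *m x 0)
  else if i == 1%N :> nat then facet X_fan (inord 0) (inord 2) (M *m x 1)
  else facet X_fan (inord 0) (inord 2) (M *m x 0).

Lemma wielandt_dual_scalar i : scalar (wielandt_dual i).
Proof.
move=> a M N; rewrite /wielandt_dual !mulmxDl -!scalemxAl !facetD !facetZ.
by case: ifP => // _; case: ifP.
Qed.

Lemma wielandt_dualE a b c M (i : 'I_3) : wielandt_matrix X a b c M ->
  wielandt_dual i M = if i == 0%N :> nat then a else if i == 1%N :> nat then b else c.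
Proof.
move=> [M0 M1 _ _]; rewrite /wielandt_dual M0 M1 !facetD !facetZ.
have p1 : facet_pair R (inord 1 : 'I_n.+1) (inord 1) by rewrite /facet_pair eqxx.
have p02 : facet_pair R (inord 0 : 'I_n.+1) (inord 2).
  by rewrite /facet_pair !inordK ?rel_coef2 ?eqxx ?orbT //; lia.
rewrite !facet_X // /facet_coef -!val_eqE /= !inordK //=; try by lia.
by case: ifP => _; [ring|case: ifP => _; ring].
Qed.

Lemma wielandt_dual_gen E i j : wielandt_gen_spec E -> wielandt_dual i (E j) = (i == j)%:R.
Proof.
move=> EP; rewrite (wielandt_dualE _ (EP j)) -val_eqE.
by case: i j => [[|[|[|i]]] //= _] [[|[|[|j]]] //= _].
Qed.

Lemma wielandt_simplex E M : wielandt_gen_spec E ->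
  simplex_cone E M <-> exists a b c, [/\ 0 <= a, 0 <= b, 0 <= c & wielandt_matrix X a b
    c M].
Proof.
move=> EP; have sumE (u : 'I_3 -> R) : wielandt_matrix X (u (inord 0)) (u (inord 1)) (u
  (inord 2))
    (\sum_i u i *: E i).
  have o k (kn : (k < 3)%N) : inord k = Ordinal kn by apply/val_inj; rewrite /= inordK.
  rewrite (o 0%N isT) (o 1%N isT) (o 2%N isT).
  rewrite !big_ord_recl big_ord0 addr0.
  have := wielandt_matrixD (wielandt_matrixZ (u ord0) (EP ord0))
    (wielandt_matrixD (wielandt_matrixZ (u (lift ord0 ord0)) (EP (lift ord0 ord0)))
      (wielandt_matrixZ (u (lift ord0 (lift ord0 ord0))) (EP (lift ord0 (lift ord0
        ord0))))).
  rewrite /= !mulr0 !mulr1 !addr0 !add0r.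
  have -> : lift ord0 ord0 = Ordinal (isT : (1 < 3)%N) by apply/val_inj.
  have -> : lift ord0 (lift ord0 ord0) = Ordinal (isT : (2 < 3)%N) by apply/val_inj.
  by have -> : ord0 = Ordinal (isT : (0 < 3)%N) by apply/val_inj.
split=> [[u u0 ->]|[a [b [c [a0 b0 c0 MW]]]]].
  by exists (u (inord 0)), (u (inord 1)), (u (inord 2)); split=> //.
pose u (i : 'I_3) : R := if i == 0%N :> nat then a else if i == 1%N :> nat then b else c.
exists u => [i|]; first by rewrite /u; case: ifP => // _; case: ifP.
apply: (wielandt_matrix_unique X_fan MW); have := sumE u.
by rewrite /u !inordK.
Qed.

Lemma wielandt_simplex_face E : wielandt_gen_spec E ->
  is_face (pi_cone K) (simplex_cone E).
Proof.
move=> EP; split; first exact: simplex_cone_convex.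
  move=> M /(wielandt_simplex _ EP)[a [b [c [a0 b0 c0 MW]]]].
  exact: wielandt_matrix_pi MW.
move=> M N /(wielandt_simplex _ EP)[a [b [c [a0 b0 c0 MW]]]] KN KMN.
by apply/(wielandt_simplex _ EP); apply: wielandt_matrix_lower MW KN KMN.
Qed.

Lemma wielandt_Phi E a b A : wielandt_gen_spec E -> 0 < a -> 0 < b ->
  wielandt_matrix X a b 1 A -> Phi (pi_cone K) A = simplex_cone E.
Proof.
move=> EP a0 b0 AW; apply/seteqP; split=> M.
  apply; split; first exact: wielandt_simplex_face.
  by move=> _ ->; apply/(wielandt_simplex _ EP); exists a, b, 1; split; rewrite ?ler01 ?ltW.
move=> /[dup] CM /(wielandt_simplex _ EP)[a' [b' [c' [a'0 b'0 c'0 MW]]]].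
move=> F [[[F0 FD FZ] FK Fface] FA].
(* [t] exceeds [a' / a], [b' / b] and [c'], so [A - t^-1 *: M] has nonnegative parameters and
   [t^-1 *: M] lies below [A]. *)
pose t := 1 + a' / a + b' / b + c'.
have a'a : 0 <= a' / a by rewrite divr_ge0 // ltW.
have b'b : 0 <= b' / b by rewrite divr_ge0 // ltW.
have t0 : 0 < t by rewrite /t; lra.
have KM : pi_cone K M by have [_ CK _] := wielandt_simplex_face EP; exact: CK.
have FtM : F (t^-1 *: M).
  apply: (Fface A); first exact: FA.
    by move=> y Ky; rewrite -scalemxAl; apply: (fan_KZ X_fan);
      [rewrite invr_ge0 ltW|exact: KM].
  have := wielandt_matrixD AW (wielandt_matrixZ (- t^-1) MW).
  rewrite scaleNr; apply: wielandt_matrix_pi => //.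
  - rewrite mulNr subr_ge0 mulrC ler_pdivrMr // /t -{1}(divfK (lt0r_neq0 a0) a').
    by rewrite mulrC ler_pM2l //; lra.
  - rewrite mulNr subr_ge0 mulrC ler_pdivrMr // /t -{1}(divfK (lt0r_neq0 b0) b').
    by rewrite mulrC ler_pM2l //; lra.
  - by rewrite mulNr subr_ge0 mulrC ler_pdivrMr // /t mul1r; lra.
by have := FZ _ _ (ltW t0) FtM; rewrite scalerA divff ?scale1r // gt_eqF.
Qed.

Lemma wielandt_relint E M : wielandt_gen_spec E -> relint (simplex_cone E) M <->
  exists c a b A, [/\ 0 < c, 0 < a /\ 0 < b, wielandt_matrix X a b 1 A & M = c *: A].
Proof.
move=> EP; have lin := wielandt_dual_scalar.
have dual i j : wielandt_dual i (E j) = (i == j)%:R := wielandt_dual_gen i j EP.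
split.
  move=> /[dup] MC /(simplex_cone_relint lin dual)[M0 _].
  have [/(wielandt_simplex _ EP)[a [b [c [_ _ _ MW]]]] _] := MC.
  have c0 := M0 (inord 2); have a0 := M0 (inord 0); have b0 := M0 (inord 1).
  rewrite !(wielandt_dualE _ MW) !inordK //= in a0 b0 c0.
  have MW' := wielandt_matrixZ c^-1 MW; rewrite mulVf ?gt_eqF // in MW'.
  exists c, (c^-1 * a), (c^-1 * b), (c^-1 *: M); split=> //.
    by split; rewrite mulr_gt0 ?invr_gt0.
  by rewrite scalerA divff ?scale1r // gt_eqF.
move=> [c [a [b [A [c0 [a0 b0] AW ->]]]]].
have MW := wielandt_matrixZ c AW.
have CM : simplex_cone E (c *: A).
  apply/(wielandt_simplex _ EP); exists (c * a), (c * b), (c * 1).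
  split; [exact/ltW/mulr_gt0|exact/ltW/mulr_gt0|by rewrite mulr1 ltW|exact: MW].
apply/(simplex_cone_relint lin dual); split; last first.
  by have [_] := (simplex_coneP lin dual _).1 CM.
move=> i; rewrite (wielandt_dualE _ MW) mulr1.
by case: ifP => _; [|case: ifP => _]; rewrite ?mulr_gt0.
Qed.

End WielandtFace.

(** * Similarity invariants of Wielandt matrices *)

Section WielandtSimilarity.
Variables (R : realType) (n : nat) (K : set 'cV[R]_n) (X : 'I_n.+1 -> 'cV[R]_n).
Hypothesis X_fan : fan K X.
Let n_ge4 := fan_n_ge4 X_fan.
Let n_even := fan_n_even X_fan.
Implicit Types (y z : 'cV[R]_n) (A B M N : 'M[R]_n).
Local Notation x k := (X (inord k)).
Local Notation r := (@rel_coef R).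

(** In the basis [x 0, ..., x n.-1] the only nonzero diagonal entry can come from [x n.-1]: its
    image [c *: x n] expands by the relation with coefficient [1] at [x n.-1], because [n] is
    even. *)
Lemma wielandt_matrix_trace a b c A : wielandt_matrix X a b c A -> \tr A = c.
Proof.
move=> [A0 A1 A2 A3]; have [L [ML LM]] := fan_basis X_fan.
set M := (\matrix_(i, j) _) in ML LM.
have colM (j : 'I_n) : col j M = x j.
  apply/matrixP => i k; rewrite !mxE ord1; congr (X _ _ _).
  by apply/val_inj; rewrite /= inordK // ltnS ltnW.
have Lx (j : 'I_n) : L *m x j = delta_mx j 0.
  by rewrite -colM colE mulmxA LM mul1mx.
have Lxn : L *m x n = \sum_(j < n) r j *: delta_mx j 0.
  have -> : x n = \sum_(j < n) r j *: x j.
    have := fan_rel_nat X_fan; rewrite big_mkord big_ord_recr /= (rel_coef_even R _ n_even).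
      by rewrite scaleN1r => /eqP; rewrite subr_eq0 => /eqP ->.
    by lia.
  by rewrite mulmx_sumr; apply: eq_bigr => j _; rewrite -scalemxAr Lx.
have Lxk (j : 'I_n) k : (k < n)%N -> (L *m x k) j 0 = (k == j :> nat)%:R.
  by move=> kn; rewrite (Lx (Ordinal kn)) mxE eqxx andbT -val_eqE eq_sym.
have Lxnj (j : 'I_n) : (L *m x n) j 0 = r j.
  rewrite Lxn summxE (bigD1 j) //= big1 ?addr0 => [|i ij].
    by rewrite !mxE !eqxx mulr1.
  by rewrite !mxE eq_sym (negPf ij) mulr0.
have -> : \tr A = \sum_(j < n) (L *m (A *m x j)) j 0.
  rewrite -{1}[A]mulmx1 -ML mulmxA mxtrace_mulC; apply: eq_bigr => j _.
  by rewrite -colM [col j M]colE !mulmxA -colE [RHS]mxE.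
have n1 : (n.-1 < n)%N by lia.
rewrite (bigD1 (Ordinal n1)) //= big1 ?addr0 => [|j jn].
  rewrite A2; last by lia.
  rewrite prednK; last by lia.
  rewrite -scalemxAr mxE Lxnj /=.
  have E := rel_coefS R (_ : 2 <= n.-1)%N; rewrite prednK in E; last by lia.
  have := E ltac:(lia); rewrite (rel_coef_even R _ n_even); last by lia.
  by move/oppr_inj => <-; rewrite mulr1.
have jn' : (j < n.-1)%N.
  by have := ltn_ord j; move: jn; rewrite -val_eqE /=; lia.
case: j jn jn' => [[|[|j]] jlt] _ /= jn.
- rewrite A0 mulmxDr -!scalemxAr mxE [X in X + _]mxE [X in _ + X]mxE.
  by rewrite !Lxk /= ?mulr0 ?addr0 //; lia.
- by rewrite A1 -scalemxAr mxE Lxk /= ?mulr0 //; lia.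
rewrite A2; last by lia.
by rewrite -scalemxAr mxE Lxk /= ?gtn_eqF ?mulr0 //; lia.
Qed.

(** The recurrence holds at [x 2], and the defect [Q] commutes with [A], so [Q] kills
    [x 2, ..., x n] and then [x 0 + a *: x 1]. One more step isolates [a *: (Q *m x 1)], where
    [a > 0] is used. *)
Lemma wielandt_matrix_poly a b A : 0 < a -> wielandt_matrix X a b 1 A ->
  A ^+ n.+1 = (1 + a * b) *: A + (a * b)%:M.
Proof.
move=> a0 AW; have [A0 A1 A2 An] := AW.
pose Q := A ^+ n.+1 - ((1 + a * b) *: A + (a * b)%:M).
suff Q0 : Q = 0 by apply/eqP; rewrite -subr_eq0; apply/eqP.
have QA y : Q *m y = 0 -> Q *m (A *m y) = 0.
  have comm : Q *m A = A *m Q.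
    rewrite /Q mulmxBl mulmxBr mulmxDl mulmxDr -scalemxAl -scalemxAr scalar_mxC.
    by rewrite -[A ^+ _ *m A]/(A ^+ _ * A) -[A *m A ^+ _]/(A * A ^+ _) -exprSr -exprS.
  by move=> Qy; rewrite mulmxA comm -mulmxA Qy mulmx0.
have Q2 : Q *m x 2 = 0.
  rewrite mulmxBl (wielandt_matrix_recurrence X_fan AW) mulmxDl -scalemxAl.
  by rewrite mul_scalar_mx subrr.
have Qk k : (k <= n - 2)%N -> Q *m x k.+2 = 0.
  elim: k => [|k IHk] kn //; have := A2 k.+2; rewrite scale1r => <-; last by lia.
  by apply/QA/IHk; lia.
have Qn : Q *m x n = 0 
  by have := Qk (n - 2)%N (leqnn _); rewrite (_ : (n - 2).+2 = n)%N //; lia.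
have Q01 : Q *m x 0 + a *: (Q *m x 1) = 0.
  by have := QA _ Qn; rewrite An scale1r mulmxDr -scalemxAr.
have Q1 : Q *m x 1 = 0.
  have := QA (x 0 + a *: x 1); rewrite mulmxDr -scalemxAr => /(_ Q01).
  rewrite mulmxDr -scalemxAr A0 A1 !mulmxDr -!scalemxAr Q2 !scaler0 !addr0 => /eqP.
  by rewrite scaler_eq0 gt_eqF //= => /eqP.
apply: (fan_map_ext X_fan) => -[|[|k]] kn; rewrite mul0mx //.
  by move: Q01; rewrite Q1 scaler0 addr0.
by apply: Qk; lia.
Qed.

(** Once [c1 = c2], the matrix [A2] satisfies the polynomial identities of both parameters. Their
    difference is [(b1 - b2) *: (A2 + 1%:M) = 0], and [A2 = - 1%:M] contradicts
    [A2 *m x 1 = b2 *: x 2]. *)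
Lemma wielandt_not_similar P b1 b2 c1 c2 A1 A2 : 0 < c1 -> 0 < c2 -> b1 <> b2 ->
  wielandt_matrix X 1 b1 1 A1 -> wielandt_matrix X 1 b2 1 A2 -> P \in unitmx ->
  invmx P *m (c1 *: A1) *m P <> c2 *: A2.
Proof.
move=> c1_gt0 c2_gt0 b12 A1W A2W Pu sim.
have c12 : c1 = c2.
  have := congr1 mxtrace sim; rewrite mxtrace_mulC mulmxA mulmxV // mul1mx !mxtraceZ.
  by rewrite (wielandt_matrix_trace A1W) (wielandt_matrix_trace A2W) !mulr1.
have A1P : A1 *m P = P *m A2.
  have := congr1 (mulmx P) sim; rewrite !mulmxA mulmxV // mul1mx -scalemxAl c12.
  by rewrite -scalemxAr => /scalerI; apply; rewrite gt_eqF.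
have powP k : A1 ^+ k *m P = P *m A2 ^+ k.
  elim: k => [|k IHk]; first by rewrite !expr0 -[1]/(1%:M) mul1mx mulmx1.
  rewrite !exprS -[A1 * _]/(A1 *m _) -[A2 * _]/(A2 *m _).
  by rewrite -mulmxA IHk mulmxA A1P -mulmxA.
have := powP n.+1; rewrite (wielandt_matrix_poly ltr01 A1W) (wielandt_matrix_poly ltr01
  A2W).
rewrite mulmxDl mulmxDr -scalemxAl -scalemxAr A1P mul_scalar_mx mul_mx_scalar !mul1r => E.
have A2E : (b1 - b2) *: (A2 + 1%:M) = 0.
  apply: (can_inj (mulKmx Pu)); rewrite mulmx0 -scalemxAr mulmxDr mulmx1.
  move: (P *m A2) E => Q E; apply/matrixP => i j; move/matrixP/(_ i j): E.
  rewrite !mxE; lra.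
have : A2 *m x 1 = - x 1.
  move/eqP: A2E; rewrite scaler_eq0 subr_eq0 => /orP[/eqP //|].
  by rewrite addr_eq0 => /eqP ->; rewrite mulNmx mul1mx.
have [_ -> _ _] := A2W => /(congr1 (facet X_fan (inord 1) (inord 1))).
have pq : facet_pair R (inord 1 : 'I_n.+1) (inord 1) by rewrite /facet_pair eqxx.
rewrite -scaleN1r !facetZ facet_X_eq1 // facet_X // /facet_coef eqxx -val_eqE /= !inordK
  //; try by lia.
by rewrite mulr0 mulr1 => /eqP; rewrite eq_sym oppr_eq0 oner_eq0.
Qed.

End WielandtSimilarity.

(** * From the given minimal cone to its fan *)

Lemma pos_sub (R : realType) p q (S D : set 'M[R]_(p, q)) :
  convex_cone D -> S `<=` D -> pos S `<=` D.
Proof.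
move=> [D0 DD DZ] SD _ [k [c [v [cv ->]]]]; elim/big_ind: _ => // i _.
by have [c0 /SD Dv] := cv i; apply: DZ.
Qed.

Lemma alternating_relation (R : realType) (V : lmodType R) n (x : nat -> V) :
    (4 <= n)%N -> ~~ odd n ->
    x 1%N + \sum_(4 <= i < n.+1 | ~~ odd i) x i = \sum_(3 <= i < n.+2 | odd i) x i ->
  \sum_(v < n.+1) rel_coef R v *: x v.+1 = 0.
Proof.
move=> n4 ev rel; rewrite -(big_mkord predT (fun k => rel_coef R k *: x k.+1)).
do 2 (rewrite big_ltn; last by lia).
rewrite scale1r scale0r add0r.
have -> : \sum_(2 <= k < n.+1) rel_coef R k *: x k.+1 =
    \sum_(3 <= i < n.+2) (-1) ^+ i *: x i.
  by rewrite [RHS]big_add1; apply: eq_big_nat => -[|[|k]].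
rewrite (bigID odd) /= addrA addrAC.
have -> : \sum_(3 <= i < n.+2 | ~~ odd i) (-1) ^+ i *: x i =
    \sum_(4 <= i < n.+1 | ~~ odd i) x i.
  (* The end indices 3 and [n + 1] are odd, so the sum over even indices loses both ends. *)
  rewrite big_mkcond big_ltn; last by lia.
  rewrite big_nat_recr /=; last by lia.
  rewrite ev addr0 add0r [RHS]big_mkcond; apply: eq_bigr => i _.
  by case: ifP => // oi; rewrite -signr_odd (negPf oi) scale1r.
rewrite rel -big_split /= big1 // => i oi.
by rewrite -signr_odd oi scaleN1r subrr.
Qed.

Section MinimalConeFan.
Variables (R : realType) (n : nat) (K : set 'cV[R]_n) (x : nat -> 'cV[R]_n).
Hypotheses (n_ge4 : (4 <= n)%N) (n_even : ~~ odd n).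

Let X (v : 'I_n.+1) := x v.+1.

Let Xo k : (k <= n)%N -> X (inord k) = x k.+1.
Proof. by move=> kn; rewrite /X inordK. Qed.

(** Generation by the extreme vectors is read off the given direct sum, and spanning comes from
    [cone_dim K n], which makes the linear span of [K] the whole space. *)
Lemma minimal_cone_fan : minimal_cone K -> extreme_vectors K x ->
    direct_sum K (pos [set x 2%N])
      (pos [set x i | i in [set i : nat | (1 <= i <= n.+1)%N /\ i <> 2%N]]) ->
    x 1%N + \sum_(4 <= i < n.+1 | ~~ odd i) x i = \sum_(3 <= i < n.+2 | odd i) x i ->
  fan K X.
Proof.
move=> [[[[K0 KD KZ] _ _ _] _] [U KU dimU] _] [x_extreme _ _] [_ _ K_sum _] rel.
pose D := [set y | exists2 c : 'I_n.+1 -> R, forall v, 0 <= c v & y = \sum_v c v *: X v].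
have D_convex : convex_cone D.
  split=> [|_ _ [c c0 ->] [d d0 ->]|a _ a0 [c c0 ->]].
  - by exists (fun=> 0) => //; rewrite big1 // => v _; rewrite scale0r.
  - exists (fun v => c v + d v) => [v|]; first exact: addr_ge0.
    by rewrite -big_split; apply: eq_bigr => v _; rewrite scalerDl.
  - exists (fun v => a * c v) => [v|]; first exact: mulr_ge0.
    by rewrite scaler_sumr; apply: eq_bigr => v _; rewrite scalerA.
have Dx i : (1 <= i <= n.+1)%N -> D (x i).
  case: i => // k kn; exists (fun v => (v == inord k)%:R) => [v|]; first exact: ler0n.
  by rewrite -X_delta Xo.
have KE y : K y <-> D y.
  split=> [|[c c0 ->]].
    rewrite K_sum => -[u uP [v vP <-]]; have [_ DD _] := D_convex; apply: DD.
      by apply: pos_sub uP => // _ ->; apply: Dx; lia.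
    by apply: pos_sub vP => // _ [i [? _] <-]; apply: Dx.
  elim/big_ind: _ => // v _; apply: KZ => //.
  by have [] := x_extreme v.+1 (ltn_ord v).
split=> // [|y]; first exact: alternating_relation.
have Ufull : U = fullv.
  by apply/eqP; rewrite eqEdim subvf dimvf dimU /dim /= muln1 leqnn.
have : lin_span K y by rewrite KU /= Ufull memvf.
move=> [k [c [v [Kv ->]]]].
have rep (i : 'I_k) : exists d : 'I_n.+1 -> R, v i = \sum_w d w *: X w.
  by have /KE[d _ dE] := Kv i; exists d.
have [d dE] := choice rep; exists (fun w => \sum_i c i * d i w).
under [RHS]eq_bigr do rewrite scaler_suml; rewrite exchange_big /=.
apply: eq_bigr => i _; rewrite {1}dE scaler_sumr.
by apply: eq_bigr => w _; rewrite scalerA.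
Qed.

Lemma A_equations_wielandt a b A : A_equations x a b A <-> wielandt_matrix X a b 1 A.
Proof.
rewrite /wielandt_matrix !Xo; try by lia.
split=> [[A0 A1 A2 A3]|[A0 A1 A2 A3]]; split.
- by rewrite scale1r.
- by [].
- by move=> k kn; rewrite scale1r !Xo ?A2 //; lia.
- by rewrite scale1r.
- by rewrite A0 scale1r.
- by [].
- case=> // k kn; have := A2 k; rewrite !Xo ?scale1r; [|lia|lia].
  by apply; lia.
- by rewrite A3 scale1r.
Qed.

End MinimalConeFan.

Theorem theorem8p5 (R : realType) (n : nat) (n_ge4 : (4 <= n)%N)
    (n_even : ~~ odd n) (K : set 'cV[R]_n) (x : nat -> 'cV[R]_n)
    (K_minimal : minimal_cone K)
    (K_exp_maximal : exp_maximal_cone n.+1 K)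
    (K_decomposable : decomposable K)
    (x_extreme : extreme_vectors K x)
    (K_sum : direct_sum K (pos [set x 2%N])
       (pos [set x i | i in [set i : nat | (1 <= i <= n.+1)%N /\ i <> 2%N]]))
    (x_relation :
       x 1%N + \sum_(4 <= i < n.+1 | ~~ odd i) x i =
       \sum_(3 <= i < n.+2 | odd i) x i) :
  exists A : R -> R -> 'M[R]_n,
    [/\ (* A alpha beta is well defined and exp-maximal K-primitive *)
        (forall alpha beta : R, 0 < alpha -> 0 < beta ->
           (forall B : 'M[R]_n, A_equations x alpha beta B <-> B = A alpha beta) /\
           exp_maximal_mx K (A alpha beta)),
        (* (i) *)
        (forall alpha beta : R, 0 < alpha -> 0 < beta ->
           [/\ is_face (pi_cone K) (Phi (pi_cone K) (A alpha beta)),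
               cone_dim (Phi (pi_cone K) (A alpha beta)) 3,
               simplicial_cone (Phi (pi_cone K) (A alpha beta)),
               (forall alpha' beta' : R, 0 < alpha' -> 0 < beta' ->
                  Phi (pi_cone K) (A alpha' beta') =
                  Phi (pi_cone K) (A alpha beta)) &
               relint (Phi (pi_cone K) (A alpha beta)) =
               [set M | exists c alpha' beta' : R,
                  [/\ 0 < c, 0 < alpha', 0 < beta' &
                      M = c *: A alpha' beta']]]),
        (* (ii) *)
        (forall B : 'M[R]_n, exp_maximal_mx K B ->
           exists c beta : R, [/\ 0 < c, 0 < beta &
             cone_equivalent K B K (c *: A 1 beta)]) &
        (* (iii) *)
        (forall beta1 beta2 : R, 0 < beta1 -> 0 < beta2 -> beta1 <> beta2 ->
           forall c1 c2 : R, 0 < c1 -> 0 < c2 ->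
             ~ cone_equivalent K (c1 *: A 1 beta1) K (c2 *: A 1 beta2))].
Proof.
have Xf := minimal_cone_fan n_ge4 n_even K_minimal x_extreme K_sum x_relation.
set X := (fun v : 'I_n.+1 => x v.+1) in Xf.
have [A' A'W] := choice (fun ab : R * R => wielandt_matrix_exists Xf ab.1 ab.2 1).
pose A a b := A' (a, b).
have AW a b : wielandt_matrix X a b 1 (A a b) by exact: A'W (a, b).
have Auniq a b B : wielandt_matrix X a b 1 B -> B = A a b.
  by move=> BW; apply: wielandt_matrix_unique Xf _ _ _ _ _ BW (AW a b).
have [E EP] := wielandt_gen_exists Xf.
have lin := wielandt_dual_scalar Xf.
have dual i j := wielandt_dual_gen Xf i j EP.
have PhiE a b : 0 < a -> 0 < b -> Phi (pi_cone K) (A a b) = simplex_cone E.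
  by move=> a0 b0; apply: wielandt_Phi Xf _ _ _ _ EP a0 b0 (AW a b).
exists A; split.
- move=> a b a0 b0; split=> [B|]; last exact: wielandt_exp_maximal Xf _ _ _ a0 b0 (AW a b).
  rewrite A_equations_wielandt //; split=> [/Auniq//|->]; exact: AW.
- move=> a b a0 b0; rewrite PhiE //; split.
  + exact: wielandt_simplex_face Xf _ EP.
  + exact: simplex_cone_dim lin dual.
  + exact: simplex_cone_simplicial lin dual.
  + by move=> a' b' a'0 b'0; rewrite PhiE.
  + apply/seteqP; split=> M.
      move=> /(wielandt_relint Xf _ EP)[c [a' [b' [B [c0 [a'0 b'0] BW ->]]]]].
      by exists c, a', b'; rewrite (Auniq _ _ _ BW).
    move=> [c [a' [b' [c0 a'0 b'0 ->]]]]; apply/(wielandt_relint Xf _ EP).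
    by exists c, a', b', (A a' b').
- move=> B /(exp_maximal_wielandt Xf)[P [c [b [B' [[c0 b0] BW Pu PK BP]]]]].
  exists c, b; split=> //; exists P; split=> //.
  by rewrite -(Auniq _ _ _ BW) -mulmxA BP mulmxA mulVmx // mul1mx.
- move=> b1 b2 b1_gt0 b2_gt0 b12 c1 c2 c1_gt0 c2_gt0 [P [Pu _]].
  exact: (wielandt_not_similar Xf c1_gt0 c2_gt0 b12 (AW 1 b1) (AW 1 b2) Pu).
Qed.
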